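(* Let $d,K,J\ge1$ be integers, let $\kappa_y,\kappa_\Psi,\kappa_h>0$ and $\ell_h\in[0,\infty)$ be given constants, except that $\ell_h$ plays no role below; let $\Sigma\in\mathbb R^{d\times d}$, $\Gamma\in\mathbb R^{K\times K}$ be symmetric positive definite, and let $\mu_0$ be a Gaussian probability measure on $\mathbb R^d$. Let $\Psi_0\colon\mathbb R^d\to\mathbb R^d$ and $h_0\colon\mathbb R^d\to\mathbb R^K$ be constant functions. For $r>0$ let $B_{\Psi_0,h_0}(r)$ be the set of pairs $(\Psi,h)$ such that $\Psi\colon\mathbb R^d\to\mathbb R^d$ is Borel measurable with $\sup_u|\Psi(u)|\le\kappa_\Psi$ and $\sup_u|\Psi(u)-\Psi_0(u)|\le r$, and $h\colon\mathbb R^d\to\mathbb R^K$ is continuous with $\sup_u|h(u)|\le\kappa_h$ and $\sup_u|h(u)-h_0(u)|\le r$. Let $B_y$ be the set of $Y^\dagger=(y_1^\dagger,\dots,y_J^\dagger)\in\mathbb R^{KJ}$ with $\max_{1\le j\le J}|y_j^\dagger|\le\kappa_y$. For $Y^\dagger\in B_y$ and $(\Psi,h)\in B_{\Psi_0,h_0}(r)$ with some $r>0$, let $\mu_0^G=\mu_0$ and, for $j=0,\dots,J-1$, $$\mu_{j+1}=\mathsf B_j\mathsf Q\mathsf P\mu_j,\qquad \mu^G_{j+1}=\mathsf B_j\mathsf G\mathsf Q\mathsf P\mu^G_j .$$ Then for every $\epsilon>0$ there exists $\delta>0$ such that $$\sup_{Y^\dagger\in B_y}\ \sup_{(\Psi,h)\in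 B_{\Psi_0,h_0}(\delta)} d_g(\mu_J^G,\mu_J)\le\epsilon .$$
   Context: Notation: $|\cdot|$ is the Euclidean norm and, for $S$ symmetric positive definite, $|v|_S=|S^{-1/2}v|$. $\mathcal P^2(\mathbb R^n)$ is the set of Borel probability measures on $\mathbb R^n$ with finite second moment; $\mathcal M(\mu)$ and $\mathcal C(\mu)$ are the mean and covariance of $\mu$. Measures and their Lebesgue densities are denoted by the same symbol. Weighted total variation metric: with $g(v)=1+|v|^2$ on $\mathbb R^n$, $d_g(\mu_1,\mu_2)=\sup_{|f|\le g}\left|\int f\,d\mu_1-\int f\,d\mu_2\right|$ for $\mu_1,\mu_2\in\mathcal P^2(\mathbb R^n)$, the supremum being over measurable $f\colon\mathbb R^n\to\mathbb R$ with $|f|\le g$ pointwise. Operators associated with $\Psi,h,\Sigma,\Gamma$ and the data: - $\mathsf P\mu(u)=\frac{1}{\sqrt{(2\pi)^d\det\Sigma}}\int_{\mathbb R^d}\exp\left(-\tfrac12|u-\Psi(v)|_\Sigma^2\right)\mu(dv)$ (the law of $\Psi(U)+\xi$ with $U\sim\mu$, $\xi\sim\mathcal N(0,\Sigma)$ independent). - $\mathsf Q\mu(u,y)=\frac{1}{\sqrt{(2\pi)^K\det\Gamma}}\exp\left(-\tfrac12|y-h(u)|_\Gamma^2\right)\mu(u)$ (the law on $\mathbb R^d\times\mathbb R^K$ of $(U,h(U)+\eta)$ with $U\sim\mu$, $\eta\sim\mathcal N(0,\Gamma)$ independent). - For $\pi$ on $\mathbb R^d\times\mathbb R^K$ with continuous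 Lebesgue density, $\mathsf B_j\pi(u)=\pi(u,y_{j+1}^\dagger)\big/\int_{\mathbb R^d}\pi(U,y_{j+1}^\dagger)\,dU$. - $\mathsf G\pi=\mathcal N(\mathcal M(\pi),\mathcal C(\pi))$ for $\pi$ with finite second moments. *)

(* Defs.v *)
(* Vectors of R^n are row vectors 'rV[R]_n, and R^d x R^K is identified with
   'rV[R]_(d + K).  The Euclidean norm is [enorm]; the library norm `|v| on
   row vectors is the sup norm (same topology). *)
From HB Require Import structures.
From mathcomp Require Import all_boot all_order all_algebra complex.
From mathcomp Require Import all_classical all_reals all_analysis.
From mathcomp Require Import measurable_realfun.

Set Implicit Arguments.
Unset Strict Implicit.
Unset Printing Implicit Defensive.

Import Order.TTheory GRing.Theory Num.Theory.
Import numFieldNormedType.Exports.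

Local Open Scope classical_set_scope.
Local Open Scope ring_scope.

Section borel_rV.
Context {R : realType} {n : nat}.

Definition borel_display : measure_display := default_measure_display.

Let borel0 : <<s @open 'rV[R]_n >> set0.
Proof. exact: sigma_algebra0. Qed.

Let borelC A : <<s @open 'rV[R]_n >> A -> <<s @open 'rV[R]_n >> (~` A).
Proof. exact: sigma_algebraC. Qed.

Let borel_bigcup (F : (set 'rV[R]_n)^nat) :
  (forall i, <<s @open 'rV[R]_n >> (F i)) ->
  <<s @open 'rV[R]_n >> (\bigcup_i F i).
Proof. exact: sigma_algebra_bigcup. Qed.

HB.instance Definition _ := @isMeasurable.Build borel_display 'rV[R]_n
  <<s @open 'rV[R]_n >> borel0 borelC borel_bigcup.

Lemma open_measurable_rV (U : set 'rV[R]_n) : open U -> measurable U.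
Proof. by move=> oU; exact: sub_sigma_algebra. Qed.

Lemma measurable_coord (i : 'I_n) :
  measurable_fun setT (fun v : 'rV[R]_n => v ord0 i).
Proof.
apply: (measurability _ (RGenOInfty.measurableE R)) => _ [_ [a ->] <-].
rewrite setTI; apply: open_measurable_rV.
apply: open_comp; last exact: interval_open.
by move=> v _; exact: coord_continuous.
Qed.

Lemma measurable_fun_rVP d (T : measurableType d) (f : T -> 'rV[R]_n) :
  (forall i, measurable_fun setT (fun t => f t ord0 i)) -> measurable_fun setT f.
Proof.
move=> mf; apply: (measurability (@open 'rV[R]_n)) => // _ [U oU <-].
rewrite setTI.
pose cball (c : 'rV[rat]_n * rat) : set 'rV[R]_n :=
  ball (map_mx (@ratr R) c.1) (ratr c.2).
have -> : U = \bigcup_(c in [set c | cball c `<=` U]) cball c.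
  apply/seteqP; split => [v Uv|v [c cU cv]]; last exact: cU.
  have /nbhs_ballP[e /= e0 eU] : nbhs v U by exact: open_nbhs_nbhs.
  have [q /andP[q0 qe]] : exists q : rat, 0 < (ratr q : R) < e / 2.
    have /rat_in_itvoo[q] : 0 < e / 2 by rewrite divr_gt0.
    by rewrite in_itv; exists q.
  have /choice[c cP] : forall i, exists c : rat, `|v ord0 i - ratr c| < ratr q.
    move=> i.
    have /rat_in_itvoo[c] : v ord0 i - ratr q < v ord0 i + ratr q.
      by rewrite ltrD2l gtrN.
    by rewrite in_itv /= => hc; exists c; rewrite ltr_distlC.
  exists (\row_i c i, q) => /=; last first.
    split=> [//|i j]; rewrite !mxE ord1 /ball /= distrC; exact: cP.
  move=> w [_ cw]; apply: eU; split=> // i j.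
  have := cw i j; rewrite !mxE ord1 /ball/= => h.
  rewrite -(subrK (ratr (c j)) (v _ _)) -addrA (le_lt_trans (ler_normD _ _))//.
  by rewrite [e]splitr ltrD// (lt_trans _ qe).
rewrite preimage_bigcup bigcup_mkcond.
apply: countable_bigcupT_measurable => [|[c q]]; first exact: countableP.
case: ifP => // _; have [q0|q0] := ltP 0 (ratr q : R); last first.
  rewrite [X in measurable X](_ : _ = set0)//.
  by apply/seteqP; split => // t [] /=; rewrite ltNge q0.
rewrite [X in measurable X](_ : _ =
    \bigcap_(i in [set: 'I_n]) ((fun t => f t ord0 i) @^-1`
      `]ratr (c ord0 i) - ratr q, ratr (c ord0 i) + ratr q[)).
  apply: fin_bigcap_measurable => // i _.
  by rewrite -[X in measurable X]setTI; exact: mf.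
apply/seteqP; split=> [t [_ /= ct] i _|t /= ct].
  have := ct ord0 i; rewrite /= mxE /ball /= in_itv /=.
  by rewrite ltr_distlC.
split=> // i j; rewrite ord1 mxE /ball /=.
by have := ct j I; rewrite /= in_itv /= ltr_distlC.
Qed.

End borel_rV.

Section lebesgue_rV.
Context {R : realType}.

Definition cons_rV n (p : R * 'rV[R]_n) : 'rV[R]_n.+1 :=
  row_mx (p.1%:M : 'rV[R]_1) p.2.

Lemma cons_rV0 n (p : R * 'rV[R]_n) : cons_rV p ord0 ord0 = p.1.
Proof.
have -> : ord0 = lshift n (ord0 : 'I_1) by exact/val_inj.
by rewrite /cons_rV (row_mxEl (p.1%:M : 'rV[R]_1) p.2) mxE eqxx.
Qed.

Lemma cons_rVS n (p : R * 'rV[R]_n) i :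
  cons_rV p ord0 (lift ord0 i) = p.2 ord0 i.
Proof.
have -> : lift ord0 i = rshift 1 i by exact/val_inj.
by rewrite /cons_rV (row_mxEr (p.1%:M : 'rV[R]_1) p.2).
Qed.

Lemma measurable_cons_rV n : measurable_fun setT (@cons_rV n).
Proof.
apply: measurable_fun_rVP => i; have [j ->|->] := unliftP ord0 i.
  under eq_fun do rewrite cons_rVS.
  apply: (@measurableT_comp _ _ _ _ _ _ (fun v : 'rV[R]_n => v ord0 j)) => //.
  exact: measurable_coord.
by under eq_fun do rewrite cons_rV0; exact: measurable_fst.
Qed.

Definition uncons_rV n (v : 'rV[R]_n.+1) : R * 'rV[R]_n :=
  (v ord0 ord0, rsubmx (v : 'rV[R]_(1 + n))).

Lemma cons_rVK n : cancel (@cons_rV n) (@uncons_rV n).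
Proof. by move=> [x v]; rewrite /uncons_rV cons_rV0 /cons_rV/= row_mxKr. Qed.

Lemma measurable_uncons_rV n : measurable_fun setT (@uncons_rV n).
Proof.
apply/measurable_fun_pair; first exact: measurable_coord.
apply: measurable_fun_rVP => i.
apply: (eq_measurable_fun (fun v : 'rV[R]_n.+1 => v ord0 (rshift 1 i))).
  by move=> v _; rewrite mxE.
exact: measurable_coord.
Qed.

Section step.
Variables (n : nat) (m : {sigma_finite_measure set 'rV[R]_n -> \bar R}).

Definition cons_lebesgue : set 'rV[R]_n.+1 -> \bar R :=
  pushforward (@lebesgue_measure R \x m)%E (@cons_rV n).

Let mcons := @measurable_cons_rV n.

Let cons_lebesgue0 : cons_lebesgue set0 = 0%E.
Proof. by rewrite /cons_lebesgue /pushforward preimage_set0 measure0. Qed.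

Let cons_lebesgue_ge0 A : (0 <= cons_lebesgue A)%E.
Proof. exact: measure_ge0. Qed.

Let cons_lebesgue_sigma_additive : semi_sigma_additive cons_lebesgue.
Proof. exact: measure_semi_sigma_additive. Qed.

HB.instance Definition _ := isMeasure.Build _ _ _ cons_lebesgue
  cons_lebesgue0 cons_lebesgue_ge0 cons_lebesgue_sigma_additive.

Let cons_lebesgue_sigma_finite : sigma_finite setT cons_lebesgue.
Proof.
have /sigma_finiteP[F [FT ndF Foo]] := sigma_finiteT (@lebesgue_measure R).
have /sigma_finiteP[G [GT ndG Goo]] := sigma_finiteT m.
exists (fun k => @uncons_rV n @^-1` (F k `*` G k)).
  rewrite -preimage_bigcup (_ : \bigcup_k (F k `*` G k) = setT) ?preimage_setT//.
  rewrite -setXTT FT GT predeqE => -[x y]; split; last first.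
    move=> [/= [i _ Fx] [k _ Gy]]; exists (maxn i k) => //; split.
    - by move: x Fx; exact/subsetPset/ndF/leq_maxl.
    - by move: y Gy; exact/subsetPset/ndG/leq_maxr.
  by move=> [i _ []/= ? ?]; split; exists i.
move=> k; have [mF Fk] := Foo k; have [mG Gk] := Goo k; split.
  rewrite -[X in measurable X]setTI; apply: measurable_uncons_rV => //.
  exact: measurableX.
rewrite /cons_lebesgue /pushforward -comp_preimage.
rewrite (_ : _ \o _ = id); last by apply/funext => p /=; rewrite cons_rVK.
by rewrite preimage_id product_measure1E// lte_mul_pinfty// ge0_fin_numE.
Qed.

HB.instance Definition _ := Measure_isSigmaFinite.Build _ _ _ cons_lebesgue
  cons_lebesgue_sigma_finite.

End step.

Fixpoint lebesgue_rV n : {sigma_finite_measure set 'rV[R]_n -> \bar R} :=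
  if n is k.+1 then cons_lebesgue (lebesgue_rV k) else dirac (0 : 'rV[R]_0).

Lemma lebesgue_rV_box n (A : 'I_n -> set R) : (forall i, measurable (A i)) ->
  lebesgue_rV n [set v | forall i, A i (v ord0 i)] =
  (\prod_(i < n) lebesgue_measure (A i))%E.
Proof.
elim: n A => [|n IHn] A mA /=.
  by rewrite big_ord0 diracE mem_set //= => -[].
rewrite big_ord_recl -(IHn (fun i => A (lift ord0 i))) //.
rewrite -product_measure1E; [|exact: (mA ord0)|]; last first.
  rewrite [X in measurable X](_ : _ = \bigcap_(i in [set: 'I_n])
     ((fun v : 'rV[R]_n => v ord0 i) @^-1` (A (lift ord0 i)))).
    apply: fin_bigcap_measurable => // i _.
    by rewrite -[X in measurable X]setTI; apply: measurable_coord.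
  by apply/seteqP; split => [v /= h i _|v h i]; [exact: h|exact: (h i I)].
rewrite /cons_lebesgue /pushforward; congr (_ _).
apply/seteqP; split=> [[x v] /= h|[x v] /= [Ax Av] i].
  split=> [|i]; first by have := h ord0; rewrite cons_rV0.
  by have := h (lift ord0 i); rewrite cons_rVS.
by have [j ->|->] := unliftP ord0 i; rewrite ?cons_rV0 ?cons_rVS.
Qed.

End lebesgue_rV.

Section linear_algebra.
Context {R : realType} {n : nat}.
Implicit Types (v : 'rV[R]_n) (S : 'M[R]_n).

Definition enorm v : R := Num.sqrt (\sum_i v ord0 i ^+ 2).

Definition spd S : Prop :=
  S^T = S /\ forall v, v != 0 -> 0 < (v *m S *m v^T) ord0 ord0.

(* S^{1/2}: the symmetric positive definite square root of S. *)
Definition sqrtmx S : 'M[R]_n := xget 0 [set T | spd T /\ T *m T = S].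

Definition wnorm S v : R := enorm (v *m invmx (sqrtmx S)).

Definition gauss_pdf (m : 'rV[R]_n) S v : R :=
  (Num.sqrt ((2 * pi) ^+ n * \det S))^-1 *
  expR (- 2^-1 * wnorm S (v - m) ^+ 2).

End linear_algebra.

Lemma poly_interp (F : fieldType) (f : F -> F) (s : seq F) :
  exists p : {poly F}, forall x, x \in s -> p.[x] = f x.
Proof.
elim: s => [|a s [p pE]]; first by exists 0.
have [as_|as_] := boolP (a \in s).
  by exists p => x; rewrite inE => /orP[/eqP ->|]; exact: pE.
pose q := \prod_(y <- s) ('X - y%:P).
have qE x : q.[x] = 0 <-> x \in s.
  rewrite -root_prod_XsubC; split=> [/eqP//|/eqP//].
exists (p + ((f a - p.[a]) / q.[a]) *: q) => x; rewrite inE !hornerE.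
have q0 : q.[a] != 0 by apply: contra as_ => /eqP /qE.
case/orP => [/eqP ->|xs]; first by rewrite divfK// addrC subrK.
by rewrite (qE x).2// mulr0 addr0 pE.
Qed.

Lemma trmx_horner_mx (F : fieldType) n (A : 'M[F]_n.+1) (p : {poly F}) :
  A^T = A -> (horner_mx A p)^T = horner_mx A p.
Proof.
move=> At; elim/poly_ind: p => [|p c IH]; first by rewrite rmorph0 trmx0.
rewrite rmorphD rmorphM/= horner_mx_X horner_mx_C linearD/= tr_scalar_mx.
rewrite -mulmxE trmx_mul IH At.
by congr (_ + _); rewrite -{1 4}(horner_mx_X A) !mulmxE -!rmorphM/= mulrC.
Qed.

Section spd_theory.
Context {R : realType}.

Lemma mulmx_trE n (v : 'rV[R]_n) : (v *m v^T) ord0 ord0 = \sum_i v ord0 i ^+ 2.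
Proof. by rewrite mxE; apply: eq_bigr => i _; rewrite mxE. Qed.

Lemma mulmx_tr_gt0 n (v : 'rV[R]_n) : v != 0 -> 0 < (v *m v^T) ord0 ord0.
Proof.
move=> v0; rewrite mulmx_trE lt_neqAle sumr_ge0 ?andbT; last first.
  by move=> i _; exact: sqr_ge0.
apply: contra v0; rewrite eq_sym psumr_eq0; last by move=> i _; exact: sqr_ge0.
move=> /allP h; apply/eqP/rowP => i; rewrite mxE.
by have := h i (mem_index_enum _); rewrite sqrf_eq0 => /eqP.
Qed.

Lemma spd_unit n (S : 'M[R]_n) : spd S -> S \in unitmx.
Proof.
move=> [_ pS]; rewrite -row_free_unit -kermx_eq0; apply: contraT => k0.
have [i ri0] : exists i, row i (kermx S) != 0.
  apply/existsP; apply: contraT; rewrite negb_exists => /forallP h.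
  case/negP: k0; apply/eqP/row_matrixP => i; rewrite row0.
  by have := h i; rewrite negbK => /eqP.
have := pS _ ri0; rewrite -row_mul mulmx_ker row0 mul0mx mxE.
by rewrite ltxx.
Qed.

Lemma sqrtmx_ex n (S : 'M[R]_n) : spd S -> exists T, spd T /\ T *m T = S.
Proof.
case: n S => [|n] S [St pS].
  by exists S; split=> //; apply/matrixP => -[].
pose phi := @real_complex R.
pose A := map_mx phi S.
have At : A^T = A by rewrite /A map_trmx St.
have Ar : A \is a mxOver Num.real.
  by apply/mxOverP => i j; rewrite mxE complex_real.
have Ah : A \is hermsymmx.
  apply: realsym_hermsym => //.
  by apply/is_hermitianmxP; rewrite expr0 scale1r map_mx_id_in ?At.
have /orthomx_spectralP AE := hermitian_normalmx Ah.
have Dr := hermitian_spectral_diag_real Ah.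
set P := spectralmx A in AE; set D := spectral_diag A in AE Dr.
have Pu : P \in unitmx by exact: spectral_unit.
pose d i : R := complex.Re (D ord0 i).
have dE i : phi (d i) = D ord0 i.
  by rewrite /phi /d RRe_real //; exact: (mxOverP Dr).
have d0 i : 0 < d i.
  have wA : row i P *m A = D ord0 i *: row i P.
    rewrite -row_mul {1}AE !mulmxA mulmxV // mul1mx mul_diag_mx.
    by apply/rowP => j; rewrite !mxE.
  have key (r : R[i] -> R) : r 0 = 0 -> {morph r : x y / x + y} ->
      (forall x y, r (phi x * y) = x * r y) ->
      map_mx r (row i P) != 0 -> 0 < d i.
    move=> r00 rD rE r0; set a := map_mx r _ in r0.
    have aS : a *m S = d i *: a.
      apply/rowP => j; move/rowP : wA => /(_ j) /(congr1 r).
      rewrite !mxE (big_morph r rD r00) -dE rE => <-; apply: eq_bigr => k _.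
      by rewrite !mxE [_ * phi _]mulrC rE mulrC.
    have := pS _ r0; rewrite aS -scalemxAl mxE pmulr_lgt0 //.
    exact: mulmx_tr_gt0.
  have ReM x y : complex.Re (phi x * y) = x * complex.Re y.
    by case: y => y1 y2 /=; rewrite mul0r subr0.
  have ImM x y : complex.Im (phi x * y) = x * complex.Im y.
    by case: y => y1 y2 /=; rewrite mul0r addr0.
  have [r0|r0] := eqVneq (map_mx (@complex.Re R) (row i P)) 0; last by apply: (key _ _ _ ReM r0) => // -[? ?] [? ?].
  have [s0|s0] := eqVneq (map_mx (@complex.Im R) (row i P)) 0; last by apply: (key _ _ _ ImM s0) => // -[? ?] [? ?].
  have : row i P = 0.
    apply/rowP => j; rewrite [RHS]mxE; apply/eqP; rewrite eq_complex /=.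
    move/rowP: r0 => /(_ j); move/rowP: s0 => /(_ j).
    by rewrite ![map_mx _ _ _ _]mxE ![(0 : 'rV__) _ _]mxE => -> ->; rewrite eqxx.
  move=> /(congr1 (mulmx^~ (invmx P))); rewrite -row_mul mulmxV// mul0mx.
  by move=> /rowP/(_ i); rewrite !mxE eqxx => /eqP; rewrite oner_eq0.
have [g gE] := poly_interp (fun x => Num.sqrt (Num.sqrt x)) [seq d i | i <- enum 'I_n.+1].
have gd i : g.[d i] ^+ 4 = d i.
  rewrite gE ?map_f ?mem_enum//.
  by rewrite -[4%N]/(2 * 2)%N exprM !sqr_sqrtr ?sqrtr_ge0 ?ltW.
have SE : horner_mx S (g ^+ 4) = S.
  apply: (map_mx_inj (f := phi)); rewrite map_horner_mx -/A AE.
  rewrite -[P in _ *m P]invmxK horner_mx_uconj ?unitmx_inv //.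
  rewrite invmxK horner_mx_diag; congr (_ *m diag_mx _ *m _).
  apply/rowP => i; rewrite !mxE -dE horner_map /=; congr (phi _).
  by rewrite horner_exp gd.
pose T0 := horner_mx S g.
have T0t : T0^T = T0 by exact: trmx_horner_mx.
have T4 : T0 *m T0 *m (T0 *m T0) = S.
  rewrite -[RHS]SE !mulmxE -!rmorphM /=; congr (horner_mx S _).
  by rewrite -[g * g]expr2 -exprD.
exists (T0 *m T0); split=> //; split; first by rewrite trmx_mul T0t.
move=> v v0; rewrite mulmxA -mulmxA.
rewrite -{2}T0t -trmx_mul; apply: mulmx_tr_gt0.
have T0u : T0 \in unitmx.
  have := spd_unit (conj St pS); rewrite -T4 !unitmx_mul.
  by case/andP => /andP[].
apply: contra v0 => /eqP vT; apply/eqP.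
by rewrite -(mulmxK T0u v) vT mul0mx.
Qed.

Lemma sqrtmxP n (S : 'M[R]_n) :
  spd S -> spd (sqrtmx S) /\ sqrtmx S *m sqrtmx S = S.
Proof. by move=> /sqrtmx_ex; exact: (@xgetPex _ 0). Qed.

Lemma wnormE n (S : 'M[R]_n) (v : 'rV[R]_n) : spd S ->
  wnorm S v ^+ 2 = (v *m invmx S *m v^T) ord0 ord0.
Proof.
move=> hS; have [hT TS] := sqrtmxP hS.
have Tu := spd_unit hT; have Su := spd_unit hS.
rewrite /wnorm /enorm sqr_sqrtr; last by apply: sumr_ge0 => i _; exact: sqr_ge0.
rewrite -mulmx_trE trmx_mul trmx_inv hT.1 !mulmxA; congr ((_ *m _) _ _).
rewrite -!mulmxA; congr (_ *m _).
set T := sqrtmx S in TS Tu *.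
by rewrite -[LHS]mulmx1 -(mulmxV Su) -{1}TS -!mulmxA !(mulKmx Tu).
Qed.

End spd_theory.

Section measures.
Context {R : realType} {n : nat}.

(* s is the standard deviation.  [normal_prob m 0] is the uniform law
   on [0, 1], hence the case split. *)
Definition normal_law (m s : R) (A : set R) : \bar R :=
  if s == 0 then dirac m A else normal_prob m s A.

(* Every linear functional is normally distributed; degenerate (singular
   covariance) Gaussians are included. *)
Definition gaussian_law (mu : probability 'rV[R]_n R) : Prop :=
  forall a : 'rV[R]_n, exists m s : R, 0 <= s /\
    forall A : set R, measurable A ->
      mu [set v | A ((v *m a^T) ord0 ord0)] = normal_law m s A.

Definition density_measure (p : 'rV[R]_n -> R) : set 'rV[R]_n -> \bar R :=
  fun A => (\int[lebesgue_rV n]_(v in A) (p v)%:E)%E.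

Definition mean (mu : set 'rV[R]_n -> \bar R) : 'rV[R]_n :=
  \row_i fine (\int[mu]_v (v ord0 i)%:E)%E.

Definition covariance_mx (mu : set 'rV[R]_n -> \bar R) : 'M[R]_n :=
  \matrix_(i, j) fine (\int[mu]_v
    ((v ord0 i - mean mu ord0 i) * (v ord0 j - mean mu ord0 j))%:E)%E.

Definition dg (mu1 mu2 : set 'rV[R]_n -> \bar R) : \bar R :=
  ereal_sup [set `|\int[mu1]_v (f v)%:E - \int[mu2]_v (f v)%:E|%E
            | f in [set f : 'rV[R]_n -> R | measurable_fun setT f /\
                      forall v, `|f v| <= 1 + enorm v ^+ 2]].

End measures.

(* The operators act on Lebesgue densities, taken as actual functions; this
   fixes the (continuous) version of the density that [analysis_op] evaluates
   at the observation.  [density_measure] turns a density into its measure. *)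
Section operators.
Context {R : realType} {d K : nat}.

Definition prediction_op (Psi : 'rV[R]_d -> 'rV[R]_d) (Sigma : 'M[R]_d)
    (mu : set 'rV[R]_d -> \bar R) : 'rV[R]_d -> R :=
  fun u => fine (\int[mu]_v (gauss_pdf (Psi v) Sigma u)%:E)%E.

Definition joint_op (h : 'rV[R]_d -> 'rV[R]_K) (Gamma : 'M[R]_K)
    (p : 'rV[R]_d -> R) : 'rV[R]_(d + K) -> R :=
  fun z => gauss_pdf (h (lsubmx z)) Gamma (rsubmx z) * p (lsubmx z).

Definition analysis_op (y : 'rV[R]_K) (q : 'rV[R]_(d + K) -> R) :
    'rV[R]_d -> R :=
  fun u => q (row_mx u y) /
           fine (\int[lebesgue_rV d]_U (q (row_mx U y))%:E)%E.

(* The Gaussian is given by its density, which presupposes that the covariance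
   of q is positive definite; this holds whenever q is in the range of
   [joint_op h Gamma \o prediction_op Psi Sigma] on probability measures. *)
Definition gaussian_op (q : 'rV[R]_(d + K) -> R) : 'rV[R]_(d + K) -> R :=
  gauss_pdf (mean (density_measure q)) (covariance_mx (density_measure q)).

Variables (Psi : 'rV[R]_d -> 'rV[R]_d) (h : 'rV[R]_d -> 'rV[R]_K).
Variables (Sigma : 'M[R]_d) (Gamma : 'M[R]_K) (mu0 : probability 'rV[R]_d R).
Variable Y : seq 'rV[R]_K.

(* Observations are indexed from 0, so that [Y`_j] is $y_{j+1}^\dagger$. *)
Fixpoint filter_law (j : nat) : set 'rV[R]_d -> \bar R :=
  if j is i.+1 then
    density_measure (analysis_op Y`_i
      (joint_op h Gamma (prediction_op Psi Sigma (filter_law i))))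
  else mu0.

Fixpoint gaussian_filter_law (j : nat) : set 'rV[R]_d -> \bar R :=
  if j is i.+1 then
    density_measure (analysis_op Y`_i (gaussian_op
      (joint_op h Gamma (prediction_op Psi Sigma (gaussian_filter_law i)))))
  else mu0.

End operators.

Section data.
Context {R : realType} {d K : nat}.

Definition model_ball (kappa_Psi kappa_h : R) (Psi0 : 'rV[R]_d -> 'rV[R]_d)
    (h0 : 'rV[R]_d -> 'rV[R]_K) (r : R) :
    set (('rV[R]_d -> 'rV[R]_d) * ('rV[R]_d -> 'rV[R]_K)) :=
  [set Psih | [/\ measurable_fun setT Psih.1,
    (forall u, enorm (Psih.1 u) <= kappa_Psi),
    (forall u, enorm (Psih.1 u - Psi0 u) <= r),
    continuous Psih.2 &
    (forall u, enorm (Psih.2 u) <= kappa_h) /\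
    (forall u, enorm (Psih.2 u - h0 u) <= r)]].

Definition observation_ball (J : nat) (kappa_y : R) :
    set (J.-tuple 'rV[R]_K) :=
  [set Y | forall j, enorm (tnth Y j) <= kappa_y].

End data.

(* Main.v *)
Require Import Defs.
From HB Require Import structures.
From mathcomp Require Import all_boot all_order all_algebra.
From mathcomp Require Import all_classical all_reals all_analysis.
From mathcomp Require Import measurable_realfun ring lra.
Import Order.TTheory GRing.Theory Num.Theory.
Import numFieldNormedType.Exports.
Set Implicit Arguments.
Unset Strict Implicit.
Unset Printing Implicit Defensive.
Local Open Scope classical_set_scope.
Local Open Scope ring_scope.

(** When Psi and h are the constants c and c', one prediction step sends every
    law to N(c, Sigma), the joint law of state and observation is the product
    Gaussian pi0 = N(c, Sigma) x N(c', Gamma), the Gaussian projection fixes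
    pi0, and conditioning pi0 on any observation gives N(c, Sigma) back.  Both
    filters thus forget their past in a single step, and when Psi and h are
    delta-close to constants one step from an arbitrary probability law still
    lands close to N(c, Sigma), uniformly in the law and in the observation.
    The theorem follows by applying this to the last of the J steps
    ([filter_step_near_gauss]) and by the triangle inequality through
    N(c, Sigma) ([dg_near_gauss]); earlier steps only have to produce
    probability measures.

    Closeness of densities is measured multiplicatively: f is log-close to g
    with constant tau when |log (f / g)| <= tau (1 + |v|^2) pointwise
    ([log_close]).  A change of the mean of a Gaussian by e is of this form with
    tau = O(e) ([gauss_pdf_shift]), and the relation survives averaging over the
    law of the state ([prediction_close]), multiplication by the likelihood
    ([joint_close]) and restriction to the slice of an observation
    ([analysis_close]).  Since a Gaussian still integrates a small quadratic
    exponential, log-closeness to a Gaussian gives O(tau) in the weighted L1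
    distance ([gauss_log_close_dist]), also after normalisation
    ([normalization_close]), and that distance dominates d_g.

    For the Gaussian filter, the weighted L1 bound puts the mean and the
    covariance of the joint density within O(tau) of those of pi0
    ([moments_close]), and Gaussian kernels depend on mean and covariance in a
    log-Lipschitz way ([gauss_kernel_perturb]), so the projected density is
    again log-close to a multiple of pi0.

    This uses the mass, mean and covariance of the density [gauss_pdf m S].  The
    mass ([integral_gauss_kernel]) is computed by induction on the dimension,
    with Schur complements.  The moments are then read off from the masses of
    exponentially tilted Gaussians ([moment_of_exponential_bound]). *)

(** * Euclidean geometry and symmetric positive definite matrices *)

Section dot_product.
Context {R : realType}.

Definition dot n (v w : 'rV[R]_n) : R := (v *m w^T) ord0 ord0.

Lemma dotE n (v w : 'rV[R]_n) : dot v w = \sum_i v ord0 i * w ord0 i.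
Proof. by rewrite /dot mxE; apply: eq_bigr => i _; rewrite mxE. Qed.

Lemma dotC n (v w : 'rV[R]_n) : dot v w = dot w v.
Proof. by rewrite !dotE; apply: eq_bigr => i _; rewrite mulrC. Qed.

Lemma dotDl n (u v w : 'rV[R]_n) : dot (u + v) w = dot u w + dot v w.
Proof. by rewrite /dot mulmxDl mxE. Qed.

Lemma dotDr n (u v w : 'rV[R]_n) : dot w (u + v) = dot w u + dot w v.
Proof. by rewrite dotC dotDl ![dot _ w]dotC. Qed.

Lemma dotZl n a (v w : 'rV[R]_n) : dot (a *: v) w = a * dot v w.
Proof. by rewrite /dot -scalemxAl mxE. Qed.

Lemma dotZr n a (v w : 'rV[R]_n) : dot v (a *: w) = a * dot v w.
Proof. by rewrite dotC dotZl dotC. Qed.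

Lemma dotNl n (v w : 'rV[R]_n) : dot (- v) w = - dot v w.
Proof. by rewrite -scaleN1r dotZl mulN1r. Qed.

Lemma dotNr n (v w : 'rV[R]_n) : dot v (- w) = - dot v w.
Proof. by rewrite dotC dotNl dotC. Qed.

Lemma dotMl n m (A : 'M[R]_(n, m)) (v : 'rV[R]_n) w :
  dot (v *m A) w = dot v (w *m A^T).
Proof. by rewrite /dot trmx_mul trmxK mulmxA. Qed.

Lemma dot_row_mx n m (a c : 'rV[R]_n) (b e : 'rV[R]_m) :
  dot (row_mx a b) (row_mx c e) = dot a c + dot b e.
Proof. by rewrite /dot tr_row_mx mul_row_col mxE. Qed.

Lemma dot_delta n (v : 'rV[R]_n) i : dot v (delta_mx ord0 i) = v ord0 i.
Proof.
rewrite dotE (bigD1 i)//= mxE !eqxx mulr1 big1 ?addr0// => j ji.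
by rewrite mxE (negbTE ji) andbF mulr0.
Qed.

Lemma enorm_sqr n (v : 'rV[R]_n) : enorm v ^+ 2 = dot v v.
Proof.
rewrite /enorm sqr_sqrtr; last by apply: sumr_ge0 => i _; exact: sqr_ge0.
by rewrite dotE.
Qed.

Lemma enorm_ge0 n (v : 'rV[R]_n) : 0 <= enorm v.
Proof. exact: sqrtr_ge0. Qed.

Lemma dotvv_ge0 n (v : 'rV[R]_n) : 0 <= dot v v.
Proof. by rewrite -enorm_sqr sqr_ge0. Qed.

Lemma dotvv_gt0 n (v : 'rV[R]_n) : v != 0 -> 0 < dot v v.
Proof. exact: mulmx_tr_gt0. Qed.

Lemma cauchy_schwarz n (v w : 'rV[R]_n) : `|dot v w| <= enorm v * enorm w.
Proof.
rewrite -ler_sqr ?nnegrE ?mulr_ge0 ?enorm_ge0// exprMn !enorm_sqr real_normK ?num_real//.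
have [->|w0] := eqVneq w 0.
  by rewrite -(scale0r (0 : 'rV[R]_n)) !dotZr !mul0r expr0n mulr0.
have := dotvv_ge0 (dot w w *: v - dot v w *: w).
rewrite dotDl !dotDr !dotNl !dotNr !dotZl !dotZr (dotC w v).
have := dotvv_gt0 w0; move: (dot v v) (dot w w) (dot v w) => a b c b0 H.
have : 0 <= b * (a * b - c ^+ 2) by nra.
by rewrite pmulr_rge0// subr_ge0.
Qed.

Lemma coord_le_enorm n (v : 'rV[R]_n) i : `|v ord0 i| <= enorm v.
Proof.
rewrite -ler_sqr ?nnegrE ?enorm_ge0// enorm_sqr dotE (bigD1 i)//=.
rewrite real_normK ?num_real// -expr2 lerDl.
by apply: sumr_ge0 => j _; rewrite -expr2 sqr_ge0.
Qed.

Lemma enorm_le_sum n (v : 'rV[R]_n) : enorm v <= \sum_i `|v ord0 i|.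
Proof.
rewrite -ler_sqr ?nnegrE ?enorm_ge0//; last exact: sumr_ge0.
rewrite enorm_sqr dotE expr2 mulr_suml; apply: ler_sum => i _.
rewrite -expr2 -real_normK ?num_real// expr2 ler_wpM2l//.
by rewrite (bigD1 i)//= lerDl sumr_ge0.
Qed.

Lemma enormD n (v w : 'rV[R]_n) : enorm (v + w) <= enorm v + enorm w.
Proof.
rewrite -ler_sqr ?nnegrE ?addr_ge0 ?enorm_ge0// sqrrD !enorm_sqr.
rewrite dotDl !dotDr (dotC w v).
have := cauchy_schwarz v w; have := ler_norm (dot v w); lra.
Qed.

Lemma enormN n (v : 'rV[R]_n) : enorm (- v) = enorm v.
Proof. by rewrite /enorm; under eq_bigr do rewrite mxE sqrrN. Qed.

Lemma enorm0 n : enorm (0 : 'rV[R]_n) = 0.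
Proof. by rewrite /enorm big1 ?sqrtr0// => i _; rewrite mxE expr0n. Qed.

Lemma enormB_sqr n (v w : 'rV[R]_n) :
  enorm (v - w) ^+ 2 <= 2 * enorm v ^+ 2 + 2 * enorm w ^+ 2.
Proof.
have := enormD v (- w); rewrite enormN.
rewrite -ler_sqr ?nnegrE ?addr_ge0 ?enorm_ge0// => /le_trans; apply.
by have := sqr_ge0 (enorm v - enorm w); nra.
Qed.

Lemma enorm_row_mx_sqr n m (v : 'rV[R]_n) (w : 'rV[R]_m) :
  enorm (row_mx v w) ^+ 2 = enorm v ^+ 2 + enorm w ^+ 2.
Proof. by rewrite !enorm_sqr dot_row_mx. Qed.

Definition entry_sum n m (A : 'M[R]_(n, m)) : R := \sum_i \sum_j `|A i j|.

Lemma entry_sum_ge0 n m (A : 'M[R]_(n, m)) : 0 <= entry_sum A.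
Proof. by do 2 apply: sumr_ge0 => ? _. Qed.

Lemma enorm_mulmx n m (v : 'rV[R]_n) (A : 'M[R]_(n, m)) :
  enorm (v *m A) <= entry_sum A * enorm v.
Proof.
apply: le_trans (enorm_le_sum _) _.
rewrite /entry_sum exchange_big /= mulr_suml; apply: ler_sum => j _.
rewrite mxE mulr_suml; apply: le_trans (ler_norm_sum _ _ _) _.
apply: ler_sum => i _; rewrite normrM mulrC ler_wpM2l//.
exact: coord_le_enorm.
Qed.

Lemma dot_mulmx_le n m (v : 'rV[R]_n) (A : 'M[R]_(n, m)) w :
  `|dot (v *m A) w| <= entry_sum A * enorm v * enorm w.
Proof.
apply: le_trans (cauchy_schwarz _ _) _.
by rewrite ler_wpM2r ?enorm_ge0// enorm_mulmx.
Qed.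

End dot_product.

Section spd_matrices.
Context {R : realType}.

Lemma dot_sym n (S : 'M[R]_n) v w : S^T = S -> dot (v *m S) w = dot (w *m S) v.
Proof. by move=> St; rewrite dotMl St dotC. Qed.

Lemma spd_ge0 n (S : 'M[R]_n) v : spd S -> 0 <= dot (v *m S) v.
Proof.
move=> [_ S0]; have [->|/S0/ltW//] := eqVneq v 0.
by rewrite mul0mx -(scale0r (0 : 'rV[R]_n)) dotZl mul0r.
Qed.

Lemma det_spd_gt0 n (S : 'M[R]_n) : spd S -> 0 < \det S.
Proof.
move=> /sqrtmxP[/spd_unit]; rewrite unitmxE unitfE => T0 <-.
by rewrite det_mulmx -expr2 exprn_even_gt0.
Qed.

(** Coercivity, from the square root: |v| = |(v T) T^-1| <= C |v T|, and
    |v T|^2 is the quadratic form. *)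
Lemma spd_coercive n (S : 'M[R]_n) : spd S ->
  exists2 l : R, 0 < l & forall v, l * enorm v ^+ 2 <= dot (v *m S) v.
Proof.
move=> hS; have [[Tt T0] TS] := sqrtmxP hS.
have Tu := spd_unit (conj Tt T0); set T := sqrtmx S in Tt T0 TS Tu.
have C0 : 0 < entry_sum (invmx T) + 1 by rewrite ltr_wpDl// entry_sum_ge0.
set C := _ + 1 in C0.
exists (C ^- 2) => [|v]; first by rewrite invr_gt0 exprn_gt0.
rewrite ler_pdivrMl ?exprn_gt0//.
have -> : dot (v *m S) v = enorm (v *m T) ^+ 2.
  by rewrite enorm_sqr -TS mulmxA dotMl Tt.
rewrite -exprMn ler_sqr ?nnegrE ?mulr_ge0 ?enorm_ge0 ?(ltW C0)//.
rewrite -{1}(mulmxK Tu v); apply: le_trans (enorm_mulmx _ _) _.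
by rewrite ler_wpM2r ?enorm_ge0// lerDl.
Qed.

Lemma spd_inv n (S : 'M[R]_n) : spd S -> spd (invmx S).
Proof.
move=> hS; have [St S0] := hS; have Su := spd_unit hS.
split; first by rewrite trmx_inv St.
move=> v v0; have w0 : v *m invmx S != 0.
  by apply: contra v0 => /eqP w0; rewrite -(mulmxKV Su v) w0 mul0mx.
by have := S0 _ w0; rewrite mulmxKV// -[X in _ < X]/(dot _ _) dotC.
Qed.

Lemma spdZ n a (S : 'M[R]_n) : 0 < a -> spd S -> spd (a *: S).
Proof.
move=> a0 [St S0]; split; first by rewrite linearZ/= St.
by move=> v v0; rewrite -scalemxAr -scalemxAl mxE mulr_gt0// S0.
Qed.

Lemma spd_block n m (S : 'M[R]_n) (T : 'M[R]_m) :
  spd S -> spd T -> spd (block_mx S 0 0 T).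
Proof.
move=> hS hT; split; first by rewrite tr_block_mx hS.1 hT.1 !trmx0.
move=> v v0; rewrite -[X in _ < X]/(dot _ _) -(hsubmxK v) mul_row_block.
rewrite !mulmx0 addr0 add0r dot_row_mx.
have [l0|l0] := eqVneq (lsubmx v) 0; last by rewrite ltr_pwDl ?spd_ge0// hS.2.
rewrite ltr_wpDl ?spd_ge0//; apply: hT.2; apply: contra v0 => /eqP r0.
by rewrite -(hsubmxK v) l0 r0 row_mx0.
Qed.

Lemma invmx_block n m (S : 'M[R]_n) (T : 'M[R]_m) : spd S -> spd T ->
  invmx (block_mx S 0 0 T) = block_mx (invmx S) 0 0 (invmx T).
Proof.
move=> hS hT; rewrite -invmx_block_diag// ?spd_unit//.
exact: spd_block.
Qed.

(** With the coercivity constant l of S and D = S' - S small, w = v S'^-1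
    satisfies l/2 |w|^2 <= dot w v, hence |w| <= 2/l |v|; the difference of the
    two quadratic forms is then read off S'^-1 - S^-1 = - S'^-1 D S^-1. *)
Lemma invmx_perturb n (S : 'M[R]_n) : spd S -> exists e0 C : R,
  [/\ 0 < e0, 0 <= C & forall S' : 'M[R]_n, S'^T = S' ->
    entry_sum (S' - S) <= e0 -> spd S' /\
    forall v, `|dot (v *m invmx S') v - dot (v *m invmx S) v|
                <= C * entry_sum (S' - S) * enorm v ^+ 2].
Proof.
move=> hS; have [l l0 lS] := spd_coercive hS.
exists (l / 2), (2 / l * entry_sum (invmx S)); split=> [||S' S't].
- by rewrite divr_gt0.
- by rewrite mulr_ge0 ?entry_sum_ge0// divr_ge0// ltW.
set D := S' - S; move=> D1; have S'E : S' = S + D by rewrite /D addrC subrK.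
have lS' v : l / 2 * enorm v ^+ 2 <= dot (v *m S') v.
  rewrite S'E mulmxDr dotDl; have := lS v; have := dot_mulmx_le v D v.
  rewrite ler_norml => /andP[+ _]; have := enorm_ge0 v.
  rewrite -mulrA -expr2; have := sqr_ge0 (enorm v).
  move: (enorm v ^+ 2) => x x0 _; nra.
have hS' : spd S'.
  split=> // v v0; apply: lt_le_trans (lS' v).
  by rewrite mulr_gt0 ?divr_gt0// enorm_sqr dotvv_gt0.
split=> // v; have Su := spd_unit hS; have S'u := spd_unit hS'.
set w := v *m invmx S'.
have wle : enorm w <= 2 / l * enorm v.
  have := lS' w; rewrite mulmxKV// => h.
  have := le_trans h (le_trans (ler_norm _) (cauchy_schwarz _ _)).
  have [->|w0] := eqVneq (enorm w) 0.
    by move=> _; rewrite mulr_ge0 ?enorm_ge0// divr_ge0// ltW.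
  rewrite expr2 mulrA ler_pM2r ?lt_neqAle ?enorm_ge0 ?andbT 1?eq_sym//.
  by rewrite -ler_pdivlMl ?divr_gt0// invf_div.
have -> : dot w v - dot (v *m invmx S) v = - dot (w *m D) (v *m invmx S).
  have DE : w *m D = v - w *m S by rewrite /D mulmxBr mulmxKV.
  have <- : dot (w *m D *m invmx S) v = dot (w *m D) (v *m invmx S).
    by rewrite dotMl (spd_inv hS).1.
  by rewrite -!dotNl -dotDl DE mulmxBl mulmxK// opprB.
rewrite normrN; apply: le_trans (dot_mulmx_le _ _ _) _.
have := enorm_mulmx v (invmx S); have := entry_sum_ge0 D.
have := entry_sum_ge0 (invmx S); have := enorm_ge0 v; have := enorm_ge0 w.
have := enorm_ge0 (v *m invmx S).
move: wle; rewrite -/(2 / l); move: (2 / l) (enorm w) (enorm v) (entry_sum D) => a b c e.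
move: (entry_sum _) (enorm (_ *m _)) => f g bac g0 b0 c0 f0 e0 gfc.
have -> : a * f * e * c ^+ 2 = e * ((a * c) * (f * c)) by ring.
by rewrite -mulrA ler_wpM2l// ler_pM.
Qed.

End spd_matrices.

(** * Measurability of Euclidean expressions *)

Section measurability.
Context {R : realType} {d : measure_display} {T : measurableType d}.

Lemma measurable_coord_comp n (f : T -> 'rV[R]_n) i :
  measurable_fun setT f -> measurable_fun setT (fun t => f t ord0 i).
Proof.
move=> mf; apply: (@measurableT_comp _ _ _ _ _ _ (fun v : 'rV[R]_n => v ord0 i)) => //.
exact: measurable_coord.
Qed.

Lemma measurable_dot n (f g : T -> 'rV[R]_n) :
  measurable_fun setT f -> measurable_fun setT g ->
  measurable_fun setT (fun t => dot (f t) (g t)).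
Proof.
move=> mf mg; under eq_fun do rewrite dotE.
by apply: measurable_sum => i; apply: measurable_funM; apply: measurable_coord_comp.
Qed.

Lemma measurable_rV_mulmx n m (f : T -> 'rV[R]_n) (A : 'M[R]_(n, m)) :
  measurable_fun setT f -> measurable_fun setT (fun t => f t *m A).
Proof.
move=> mf; apply: measurable_fun_rVP => j; under eq_fun do rewrite mxE.
by apply: measurable_sum => i; apply: measurable_funM => //; exact: measurable_coord_comp.
Qed.

Lemma measurable_rVB n (f g : T -> 'rV[R]_n) :
  measurable_fun setT f -> measurable_fun setT g ->
  measurable_fun setT (fun t => f t - g t).
Proof.
move=> mf mg; apply: measurable_fun_rVP => j; under eq_fun do rewrite mxE [X in _ + X]mxE.
by apply: measurable_funB; exact: measurable_coord_comp.
Qed.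

Lemma measurable_lsubmx n m (f : T -> 'rV[R]_(n + m)) :
  measurable_fun setT f -> measurable_fun setT (fun t => lsubmx (f t)).
Proof.
move=> mf; apply: measurable_fun_rVP => j; under eq_fun do rewrite mxE.
exact: measurable_coord_comp.
Qed.

Lemma measurable_rsubmx n m (f : T -> 'rV[R]_(n + m)) :
  measurable_fun setT f -> measurable_fun setT (fun t => rsubmx (f t)).
Proof.
move=> mf; apply: measurable_fun_rVP => j; under eq_fun do rewrite mxE.
exact: measurable_coord_comp.
Qed.

Lemma measurable_row_mx n m (f : T -> 'rV[R]_n) (g : T -> 'rV[R]_m) :
  measurable_fun setT f -> measurable_fun setT g ->
  measurable_fun setT (fun t => row_mx (f t) (g t)).
Proof.
move=> mf mg; apply: measurable_fun_rVP => j; rewrite -(splitK j).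
case: (fintype.split j) => k /=.
  by under eq_fun do rewrite row_mxEl; exact: measurable_coord_comp.
by under eq_fun do rewrite row_mxEr; exact: measurable_coord_comp.
Qed.

End measurability.

(** * The Gaussian integral *)

Section gaussian_kernel.
Context {R : realType}.

Definition gauss_kernel n (Q : 'M[R]_n) (m v : 'rV[R]_n) : R :=
  expR (- 2^-1 * dot ((v - m) *m Q) (v - m)).

Lemma measurable_gauss_kernel d (T : measurableType d) n (Q : 'M[R]_n)
    (f g : T -> 'rV[R]_n) :
  measurable_fun setT f -> measurable_fun setT g ->
  measurable_fun setT (fun t => gauss_kernel Q (f t) (g t)).
Proof.
move=> mf mg; apply: measurableT_comp => //; apply: measurable_funM => //.
by apply: measurable_dot; first apply: measurable_rV_mulmx; exact: measurable_rVB.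
Qed.

Lemma integral_gauss1 (q M : R) : 0 < q ->
  (\int[lebesgue_measure]_x (expR (- 2^-1 * (q * (x - M) ^+ 2)))%:E =
   (Num.sqrt (2 * pi / q))%:E)%E.
Proof.
move=> q0; pose s := Num.sqrt q^-1.
have s2 : s ^+ 2 = q^-1 by rewrite sqr_sqrtr// invr_ge0 ltW.
have s0 : s != 0 by rewrite gt_eqF// sqrtr_gt0 invr_gt0.
have pk0 := normal_peak_gt0 s0.
have := integral_normal_pdf M s; rewrite normal_pdfE//.
under eq_integral do rewrite EFinM.
rewrite ge0_integralZl_EFin//; last 3 first.
- by move=> x _; rewrite lee_fin normal_fun_ge0.
- by apply/measurable_EFinP; exact: measurable_normal_fun.
- exact: ltW.
under eq_integral => x _.
  rewrite /normal_fun s2 (_ : - _ / _ = - 2^-1 * (q * (x - M) ^+ 2)); last first.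
    by field; rewrite gt_eqF.
  over.
have -> : Num.sqrt (2 * pi / q) = (normal_peak s)^-1.
  by rewrite invrK s2; congr Num.sqrt; rewrite -mulr_natl; ring.
case: (integral _ _ _) => [r||] /=.
- by rewrite -EFinM => -[] h; congr EFin; rewrite -[r]mul1r -[1](mulVf (lt0r_neq0 pk0)) -mulrA h mulr1.
- by rewrite gt0_muley// lte_fin.
- by rewrite gt0_muleNy// lte_fin.
Qed.

Section schur_complement.
Variables (n : nat) (S : 'M[R]_(1 + n)).
Hypothesis hS : spd S.

Let q := S ord0 ord0.
Let b : 'rV[R]_n := ursubmx S.
Definition schur : 'M[R]_n :=
  drsubmx S - (S ord0 ord0)^-1 *: ((ursubmx S : 'rV_n)^T *m ursubmx S).

Let S_block : S = block_mx q%:M b b^T (drsubmx S).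
Proof.
rewrite -[LHS]submxK; congr block_mx.
- by apply/matrixP => i j; rewrite !ord1 !mxE eqxx mulr1n; congr (S _ _); exact/val_inj.
- by rewrite /b trmx_ursub hS.1.
Qed.

Let dot_scalarr (u : 'rV[R]_1) a : dot u a%:M = u ord0 ord0 * a.
Proof. by rewrite /dot tr_scalar_mx mul_mx_scalar mxE mulrC. Qed.

Let mul_rank1 (w c : 'rV[R]_n) : w *m (c^T *m c) = dot w c *: c.
Proof. by rewrite mulmxA [w *m _]mx11_scalar mul_scalar_mx. Qed.

Lemma schur_head_gt0 : 0 < q.
Proof.
have e0 : row_mx (1%:M : 'rV[R]_1) (0 : 'rV_n) != 0.
  apply/eqP => /(congr1 lsubmx); rewrite row_mxKl linear0 => /matrixP/(_ ord0 ord0).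
  by rewrite !mxE eqxx => /eqP; rewrite oner_eq0.
have := hS.2 _ e0; rewrite -[X in _ < X]/(dot _ _) S_block mul_row_block.
rewrite !mul0mx !addr0 dot_row_mx dot_scalarr mul1mx mxE eqxx mulr1n mulr1.
by rewrite -(scale0r (0 : 'rV[R]_n)) dotZr mul0r addr0.
Qed.

(** Completing the square in the first coordinate. *)
Lemma dot_schur (a : R) (w : 'rV[R]_n) :
  dot (row_mx a%:M w *m S) (row_mx a%:M w) =
  q * (a + q^-1 * dot b w) ^+ 2 + dot (w *m schur) w.
Proof.
have q0 := schur_head_gt0.
rewrite {1}S_block mul_row_block dot_row_mx dot_scalarr -scalar_mxM mul_scalar_mx.
rewrite /schur mulmxBr -scalemxAr mul_rank1 !dotDl !dotNl !dotZl -/b -/q.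
rewrite mxE -[(w *m b^T) _ _]/(dot w b) mxE eqxx mulr1n (dotC w b).
by field; rewrite gt_eqF.
Qed.

Lemma spd_schur : spd schur.
Proof.
split.
  rewrite /schur linearB /= linearZ /= trmx_mul trmxK trmx_drsub.
  by rewrite hS.1.
move=> w w0; rewrite -[X in _ < X]/(dot _ _).
have e0 : row_mx (- (q^-1 * dot b w))%:M w != 0.
  by apply: contra w0 => /eqP/(congr1 rsubmx); rewrite row_mxKr linear0 => ->.
have := hS.2 _ e0; rewrite -[X in _ < X]/(dot _ _) dot_schur addNr.
by rewrite expr0n mulr0 add0r.
Qed.

Lemma det_schur : \det S = q * \det schur.
Proof.
have q0 := schur_head_gt0.
have -> : S = block_mx 1%:M 0 (q^-1 *: b^T) 1%:M *m block_mx q%:M b 0 schur.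
  rewrite mulmx_block !mul1mx !mul0mx !addr0 {1}S_block; congr block_mx.
    by rewrite mul_mx_scalar scalerA divff ?gt_eqF// scale1r.
  by rewrite -scalemxAl /schur addrC subrK.
by rewrite det_mulmx det_lblock det_ublock !det1 !mul1r det_scalar1.
Qed.

End schur_complement.

(** The normalising constant of a Gaussian, by induction on the dimension:
    integrating out the first coordinate gives a one-dimensional Gaussian and
    leaves the Gaussian of the Schur complement, and the determinants multiply
    accordingly. *)
Theorem integral_gauss_kernel n (Q : 'M[R]_n) (m : 'rV[R]_n) : spd Q ->
  (\int[lebesgue_rV n]_v (gauss_kernel Q m v)%:E =
   (Num.sqrt ((2 * pi) ^+ n / \det Q))%:E)%E.
Proof.
have mk k (P : 'M[R]_k) (p : 'rV_k) :
    measurable_fun setT (fun v => (gauss_kernel P p v)%:E).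
  apply/measurable_EFinP.
  apply: (@measurable_gauss_kernel _ _ _ _ (cst p) id) => //.
elim: n Q m => [|n IH] Q m hQ /=.
  rewrite integral_dirac//; last exact: mk.
  rewrite diracT mul1e.
  rewrite /gauss_kernel dotE big_ord0 mulr0 expR0 expr0 det_mx00 divr1.
  by rewrite sqrtr1.
rewrite /cons_lebesgue ge0_integral_pushforward//; last 3 first.
- exact: measurable_cons_rV.
- exact: mk.
- by move=> v _; rewrite lee_fin expR_ge0.
rewrite preimage_setT fubini_tonelli2//; last 2 first.
- exact: (measurableT_comp (mk _ _ _) (@measurable_cons_rV R n)).
- by move=> p; rewrite lee_fin expR_ge0.
have q0 := schur_head_gt0 hQ; set q := Q ord0 ord0 in q0.
set m1 := rsubmx (m : 'rV_(1 + n)).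
pose c (w : 'rV[R]_n) := q^-1 * dot (ursubmx (Q : 'M[R]_(1 + n)) : 'rV_n) (w - m1).
have kE x w : gauss_kernel Q m (cons_rV (x, w)) =
   expR (- 2^-1 * (q * (x - (m ord0 ord0 - c w)) ^+ 2)) *
   gauss_kernel (schur (Q : 'M[R]_(1 + n))) m1 w.
  rewrite /gauss_kernel -expRD -mulrDr; congr (expR (_ * _)).
  have -> : cons_rV (x, w) - m = cons_rV (x - m ord0 ord0, w - m1).
    apply/(@rowP _ n.+1) => i; have [j ->|->] := unliftP ord0 i;
      rewrite mxE [X in _ + X]mxE ?cons_rV0 ?cons_rVS //=.
    by rewrite /m1 !mxE; congr (_ - m _ _); exact/val_inj.
  rewrite /cons_rV /=.
  rewrite dot_schur// -/q -/(c w); congr (_ * _ ^+ 2 + _).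
  by rewrite opprB addrA addrAC.
have inner w : (\int[lebesgue_measure]_x (gauss_kernel Q m (cons_rV (x, w)))%:E =
    (Num.sqrt (2 * pi / q))%:E * (gauss_kernel (schur (Q : 'M[R]_(1 + n))) m1 w)%:E)%E.
  under eq_integral do rewrite kE EFinM.
  rewrite ge0_integralZr ?integral_gauss1 ?lee_fin ?expR_ge0//.
  apply/measurable_EFinP/measurableT_comp => //.
  by do 2 apply: measurable_funM => //; apply: measurable_funX; exact: measurable_funB.
rewrite /fubini_G; under eq_integral do rewrite /= inner.
rewrite ge0_integralZl_EFin ?sqrtr_ge0//; last 2 first.
- by move=> w _; rewrite lee_fin expR_ge0.
- exact: mk.
rewrite (IH _ _ (spd_schur hQ)) -EFinM -sqrtrM; last by rewrite divr_ge0 ?mulr_ge0 ?pi_ge0// ltW.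
rewrite (det_schur hQ) -/q exprS; congr (Num.sqrt _)%:E.
by rewrite (invfM q); ring.
Qed.

End gaussian_kernel.

(** * Moments of Gaussian densities *)

Lemma sqr_bound_eq0 (R : realType) (s0 C x : R) : 0 < s0 ->
  (forall s, `|s| <= s0 -> s * x <= C * s ^+ 2) -> x = 0.
Proof.
move=> s00 H; have key t : 0 < t -> t <= s0 -> `|x| <= C * t.
  move=> t0 ts; have := H t; have := H (- t).
  rewrite normrN gtr0_norm// sqrrN => /(_ ts) h1 /(_ ts) h2.
  by rewrite ler_norml -(ler_pM2l t0) -[X in _ && X](ler_pM2l t0); apply/andP; split; nra.
apply/eqP; rewrite -normr_le0; apply/ler_addgt0Pr => e e0; rewrite add0r.
have C0 : 0 < `|C| + 1 by rewrite ltr_wpDl.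
pose t := Num.min s0 (e / (`|C| + 1)).
have t0 : 0 < t by rewrite lt_min s00 divr_gt0.
apply: le_trans (key t t0 _) _; first by rewrite ge_min lexx.
have : t <= e / (`|C| + 1) by rewrite ge_min lexx orbT.
rewrite ler_pdivlMr// => h; apply: le_trans h.
by rewrite mulrC ler_pM2l//; have := ler_norm C; lra.
Qed.

(** Differentiating a moment generating function at 0 without differentiating:
    e^(sX) lies above its tangent 1 + sX for s of either sign, so an upper
    bound 1 + s c + O(s^2) on the integral of e^(sX) forces the integral of X
    to be c. *)
Lemma moment_of_exponential_bound d (T : measurableType d) (R : realType)
    (mu : {measure set T -> \bar R}) (rho X : T -> R) (c C s0 : R) :
  measurable_fun setT rho -> (forall v, 0 <= rho v) ->
  (\int[mu]_v (rho v)%:E = 1)%E -> measurable_fun setT X -> 0 < s0 ->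
  (forall s, `|s| <= s0 ->
    (\int[mu]_v (expR (s * X v) * rho v)%:E <= (1 + s * c + C * s ^+ 2)%:E)%E) ->
  mu.-integrable setT (fun v => (X v * rho v)%:E) /\
  (\int[mu]_v (X v * rho v)%:E = c%:E)%E.
Proof.
move=> mrho rho0 rho1 mX s00 H.
have me s : measurable_fun setT (fun v => (expR (s * X v) * rho v)%:E).
  by apply/measurable_EFinP; apply: measurable_funM => //; apply: measurableT_comp => //; apply: measurable_funM.
have ie s : `|s| <= s0 -> mu.-integrable setT (fun v => (expR (s * X v) * rho v)%:E).
  move=> ss; apply/integrableP; split => //.
  under eq_integral => v _ do rewrite gee0_abs ?lee_fin ?mulr_ge0 ?expR_ge0//.
  exact: le_lt_trans (H s ss) (ltry _).
have irho : mu.-integrable setT (fun v => (rho v)%:E).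
  apply/integrableP; split; first exact/measurable_EFinP.
  under eq_integral => v _ do rewrite gee0_abs ?lee_fin//.
  by rewrite rho1 ltry.
have mXr : measurable_fun setT (fun v => (X v * rho v)%:E).
  by apply/measurable_EFinP; exact: measurable_funM.
have iX : mu.-integrable setT (fun v => (X v * rho v)%:E).
  have i1 := integrableD measurableT (ie s0 _) (ie (- s0) _).
  rewrite normrN gtr0_norm// in i1; have {}i1 := i1 (lexx _) (lexx _).
  have i2 := integrableZl measurableT s0^-1 i1.
  apply: (le_integrable measurableT mXr _ i2) => v _ /=.
  rewrite lee_fin !normrM (ger0_norm (rho0 v)).
  rewrite (@ger0_norm _ s0^-1) ?invr_ge0 ?(ltW s00)//.
  rewrite (@ger0_norm _ (_ + _)); last by rewrite addr_ge0// mulr_ge0// expR_ge0.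
  rewrite -mulrDl mulrA ler_wpM2r// ler_pdivlMl//.
  have h1 := expR_ge1Dx (s0 * X v); have h2 := expR_ge1Dx (- s0 * X v).
  have h3 := expR_ge0 (s0 * X v); have h4 := expR_ge0 (- s0 * X v).
  rewrite -(gtr0_norm s00) -normrM ler_norml !gtr0_norm//.
  by apply/andP; split; lra.
split=> //; have fX := integrable_fin_num measurableT iX.
rewrite -(fineK fX); congr EFin; apply/eqP; rewrite -subr_eq0; apply/eqP.
apply: (@sqr_bound_eq0 _ s0 C) => // s ss.
have : (\int[mu]_v ((rho v)%:E + s%:E * (X v * rho v)%:E) <= (1 + s * c + C * s ^+ 2)%:E)%E.
  apply: le_trans (H s ss); apply: le_integral => //.
  - by apply: integrableD => //; exact: integrableZl.
  - exact: ie.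
  - move=> v _; rewrite lee_fin mulrA -[X in X + _]mul1r -mulrDl ler_wpM2r//.
    exact: expR_ge1Dx.
rewrite integralD//; last exact: integrableZl.
rewrite integralZl// rho1 -(fineK fX) -EFinM -EFinD lee_fin.
by rewrite mulrBr; lra.
Qed.

Section gaussian_moments.
Context {R : realType}.

(** The rank-one determinant formula: eliminate either diagonal block of
    the bordered matrix [[1, -a], [t a^T, Q]]. *)
Lemma det_rank1_update n (Q : 'M[R]_n) (a : 'rV[R]_n) t : Q \in unitmx ->
  \det (Q + t *: (a^T *m a)) = \det Q * (1 + t * dot (a *m invmx Q) a).
Proof.
move=> Qu; pose M := block_mx 1%:M (- a) (t *: a^T) Q.
have M1 : M = block_mx 1%:M 0 (t *: a^T) 1%:M *m
              block_mx 1%:M (- a) 0 (Q + t *: (a^T *m a)).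
  rewrite mulmx_block !mul1mx !mul0mx !mulmx1 !addr0 mulmxN -scalemxAl.
  by rewrite addrCA addNr addr0.
have M2 : M = block_mx (1 + t * dot (a *m invmx Q) a)%:M (- a) 0 Q *m
              block_mx 1%:M 0 (t *: (invmx Q *m a^T)) 1%:M.
  rewrite mulmx_block !mulmx1 !mulmx0 !add0r -[Q *m _]scalemxAr mulKVmx//.
  congr (block_mx _ _ _ _); rewrite raddfD /= mulNmx -scalemxAr mulmxA.
  rewrite [a *m invmx Q *m a^T]mx11_scalar -/(dot _ _) scale_scalar_mx.
  by rewrite addrK.
have := congr1 determinant M2; rewrite M1 !det_mulmx !det_lblock !det_ublock.
by rewrite !det1 !mul1r !mulr1 det_scalar1 mulrC.
Qed.

Variables (n : nat) (m : 'rV[R]_n) (S : 'M[R]_n).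
Hypothesis hS : spd S.

Let cst_gt0 : 0 < (2 * pi) ^+ n * \det S.
Proof. by rewrite mulr_gt0 ?det_spd_gt0// exprn_gt0// mulr_gt0// pi_gt0. Qed.

Lemma gauss_pdfE v : gauss_pdf m S v =
  (Num.sqrt ((2 * pi) ^+ n * \det S))^-1 * gauss_kernel (invmx S) m v.
Proof. by rewrite /gauss_pdf wnormE. Qed.

Lemma gauss_pdf_gt0 v : 0 < gauss_pdf m S v.
Proof. by rewrite gauss_pdfE mulr_gt0 ?expR_gt0// invr_gt0 sqrtr_gt0. Qed.

Lemma gauss_pdf_ge0 v : 0 <= gauss_pdf m S v.
Proof. exact/ltW/gauss_pdf_gt0. Qed.

Lemma measurable_gauss_pdf : measurable_fun setT (gauss_pdf m S).
Proof.
rewrite (_ : gauss_pdf m S = fun v => (Num.sqrt ((2 * pi) ^+ n * \det S))^-1 *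
  gauss_kernel (invmx S) m v); last by apply/funext => v; exact: gauss_pdfE.
apply: measurable_funM => //.
exact: (@measurable_gauss_kernel _ _ _ _ _ (cst m) id).
Qed.

(** Exponential tilts of [gauss_pdf m S] are multiples of Gaussian kernels with
    another mean p and another precision Q; writing the multiple as a square
    keeps it nonnegative. *)
Lemma integral_gauss_tilt Q p c : spd Q ->
  (\int[lebesgue_rV n]_v ((Num.sqrt ((2 * pi) ^+ n * \det S))^-1
      * (c ^+ 2 * gauss_kernel Q p v))%:E =
   (c ^+ 2 * Num.sqrt (\det (invmx S) / \det Q))%:E)%E.
Proof.
move=> hQ; under eq_integral do rewrite mulrA EFinM.
rewrite ge0_integralZl_EFin//; last 3 first.
- by move=> v _; rewrite lee_fin expR_ge0.
- by apply/measurable_EFinP; exact: (@measurable_gauss_kernel _ _ _ _ _ (cst p) id).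
- by rewrite mulr_ge0 ?sqr_ge0// invr_ge0 sqrtr_ge0.
rewrite integral_gauss_kernel// -EFinM mulrAC -sqrtrV ?ltW// -sqrtrM ?invr_ge0 ?ltW//.
rewrite mulrC; congr (_ * Num.sqrt _)%:E.
rewrite det_inv invfM; have dS := det_spd_gt0 hS.
have p0 : 0 < (2 * pi : R) ^+ n by rewrite exprn_gt0// mulr_gt0// pi_gt0.
by rewrite mulrACA mulVf ?gt_eqF// mul1r.
Qed.

Lemma integral_gauss_pdf : (\int[lebesgue_rV n]_v (gauss_pdf m S v)%:E = 1)%E.
Proof.
have := integral_gauss_tilt m 1 (spd_inv hS); rewrite expr1n mul1r divff; last first.
  by rewrite gt_eqF//; exact: det_spd_gt0 (spd_inv hS).
by rewrite sqrtr1 => <-; apply: eq_integral => v _; rewrite gauss_pdfE mul1r.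
Qed.

(** By completing the square, the tilt e^(s (v - m).a) moves the mean and
    multiplies the mass by e^(s^2 a S a^T / 2) = 1 + O(s^2), without first-order
    term. *)
Lemma gauss_moment1 a :
  (lebesgue_rV n).-integrable setT (fun v => (dot (v - m) a * gauss_pdf m S v)%:E) /\
  (\int[lebesgue_rV n]_v (dot (v - m) a * gauss_pdf m S v)%:E = 0)%E.
Proof.
set sg := dot (a *m S) a.
have sg0 : 0 <= sg by exact: spd_ge0.
have sg1 : 0 < sg + 1 by lra.
apply: (@moment_of_exponential_bound _ _ _ _ _ _ _ sg (Num.min 1 (sg + 1)^-1)).
- exact: measurable_gauss_pdf.
- exact: gauss_pdf_ge0.
- exact: integral_gauss_pdf.
- apply: measurable_dot => //; exact: measurable_rVB.
- by rewrite lt_min ltr01 invr_gt0.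
move=> s; rewrite le_min => /andP[s1 s2].
have E v : expR (s * dot (v - m) a) * gauss_pdf m S v =
    (Num.sqrt ((2 * pi) ^+ n * \det S))^-1 *
    (expR (2^-1 * (2^-1 * (s ^+ 2 * sg))) ^+ 2 *
     gauss_kernel (invmx S) (m + s *: (a *m S)) v).
  rewrite gauss_pdfE mulrCA; congr (_ * _).
  rewrite /gauss_kernel expr2 -!expRD; congr expR.
  rewrite opprD addrA; move: (v - m) => w.
  have Qt := (spd_inv hS).1.
  have zQ : (s *: (a *m S)) *m invmx S = s *: a by rewrite -scalemxAl mulmxK ?spd_unit.
  have zz : dot (s *: a) (s *: (a *m S)) = s ^+ 2 * sg.
    by rewrite dotZl dotZr mulrA -expr2 dotC.
  have wz : dot (w *m invmx S) (s *: (a *m S)) = s * dot w a.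
    by rewrite (dot_sym _ _ Qt) zQ dotZl dotC.
  rewrite mulmxBl zQ !dotDl !dotDr !dotNl !dotNr zz wz dotZl (dotC a w).
  by field.
under eq_integral do rewrite E.
rewrite (integral_gauss_tilt _ _ (spd_inv hS)) divff ?sqrtr1 ?mulr1; last first.
  by rewrite gt_eqF//; exact: det_spd_gt0 (spd_inv hS).
rewrite lee_fin mulr0 addr0 expr2 -expRD.
set t := 2^-1 * (s ^+ 2 * sg); rewrite (_ : _ + _ = t); last by rewrite /t; field.
have s20 := sqr_ge0 s.
have t0 : 0 <= t by rewrite mulr_ge0// mulr_ge0.
have t1 : t <= 2^-1.
  rewrite /t ler_piMr//; apply: le_trans (_ : `|s| * (sg + 1) <= _).
    rewrite -real_normK ?num_real// expr2 -mulrA ler_wpM2l//.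
    by have := normr_ge0 s; nra.
  by rewrite -ler_pdivlMr// mul1r.
have h := expR_ge1Dx (- t); have h0 := expR_gt0 t.
have : expR t * expR (- t) = 1 by rewrite -expRD subrr expR0.
have -> : sg * s ^+ 2 = 2 * t by rewrite /t; field.
move: (expR t) (expR (- t)) h h0 => x y h h0 xy.
have : x * (1 - t) <= 1 by rewrite -{2}xy ler_pM2l.
nra.
Qed.

(** The tilt e^(s ((v - m).a)^2) subtracts 2 s a^T a from the precision and so
    multiplies the mass by (1 - 2 s a S a^T)^(-1/2) = 1 + s a S a^T + O(s^2). *)
Lemma gauss_moment2 a :
  (lebesgue_rV n).-integrable setT (fun v => (dot (v - m) a ^+ 2 * gauss_pdf m S v)%:E) /\
  (\int[lebesgue_rV n]_v (dot (v - m) a ^+ 2 * gauss_pdf m S v)%:E = (dot (a *m S) a)%:E)%E.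
Proof.
set sg := dot (a *m S) a; set Q := invmx S.
have hQ : spd Q by exact: spd_inv.
have sg0 : 0 <= sg by exact: spd_ge0.
have [l l0 lQ] := spd_coercive hQ.
set b := enorm a ^+ 2; have b0 : 0 <= b by exact: sqr_ge0.
(* The first bound on s keeps the tilted precision Qs positive definite, the
   second one gives |2 s sg| <= 1/2. *)
pose s0 := Num.min (l / (4 * (b + 1))) (4 * (sg + 1))^-1.
apply: (@moment_of_exponential_bound _ _ _ _ _ _ _ (4 * sg ^+ 2) s0).
- exact: measurable_gauss_pdf.
- exact: gauss_pdf_ge0.
- exact: integral_gauss_pdf.
- by apply: measurable_funX; apply: measurable_dot => //; exact: measurable_rVB.
- by rewrite lt_min divr_gt0 ?invr_gt0 ?mulr_gt0//; lra.
move=> s; rewrite le_min => /andP[s1 s2].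
have b1 : 0 < 4 * (b + 1) by lra.
have g1 : 0 < 4 * (sg + 1) by lra.
move: s1 s2; rewrite ler_pdivlMr// -[_^-1]mul1r ler_pdivlMr// => s1 s2.
pose Qs := Q + (- (2 * s)) *: (a^T *m a).
have dQs w : dot (w *m Qs) w = dot (w *m Q) w - 2 * s * dot w a ^+ 2.
  rewrite mulmxDr dotDl -scalemxAr dotZl mulmxA [w *m a^T]mx11_scalar mul_scalar_mx.
  by rewrite dotZl -/(dot w a) (dotC a w); ring.
have hQs : spd Qs.
  split.
    by rewrite /Qs linearD /= linearZ /= trmx_mul trmxK hQ.1.
  move=> w w0; rewrite -[X in _ < X]/(dot _ _) dQs.
  have := lQ w; have := cauchy_schwarz w a.
  have w1 : 0 < enorm w ^+ 2 by rewrite enorm_sqr dotvv_gt0.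
  rewrite -ler_sqr ?nnegrE ?mulr_ge0 ?enorm_ge0// exprMn -/b real_normK ?num_real//.
  move: w1; move: (enorm w ^+ 2) (dot w a ^+ 2) (sqr_ge0 (dot w a)) => x y y0 x0 h1 h2.
  have h3 : 2 * s * y <= 2 * `|s| * y by rewrite ler_wpM2r// ler_wpM2l// ler_norm.
  have h4 : 2 * `|s| * y <= 2 * `|s| * (x * b) by rewrite ler_wpM2l// mulr_ge0.
  have h5 : x * (`|s| * (4 * (b + 1))) <= x * l by rewrite ler_pM2l.
  have h6 : 0 <= x * `|s| by rewrite mulr_ge0// ltW.
  have h7 : 0 < l * x by rewrite mulr_gt0.
  nra.
have E v : expR (s * dot (v - m) a ^+ 2) * gauss_pdf m S v =
    (Num.sqrt ((2 * pi) ^+ n * \det S))^-1 * (1 ^+ 2 * gauss_kernel Qs m v).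
  rewrite gauss_pdfE mulrCA; congr (_ * _).
  by rewrite expr1n mul1r /gauss_kernel -expRD dQs; congr expR; field.
under eq_integral do rewrite E.
rewrite integral_gauss_tilt// expr1n mul1r lee_fin.
rewrite det_rank1_update ?spd_unit// invmxK -/sg -/Q.
have dQ := det_spd_gt0 hQ.
rewrite invfM mulrA divff ?gt_eqF// mul1r mulNr.
set u := 2 * s * sg.
have u1 : `|u| <= 2^-1.
  rewrite /u !normrM (ger0_norm sg0) ger0_norm//.
  have := normr_ge0 s; nra.
move: u1; rewrite ler_norml => /andP[u1 u2].
have -> : s * sg = u / 2 by rewrite /u; field.
have -> : 4 * sg ^+ 2 * s ^+ 2 = u ^+ 2 by rewrite /u; ring.
(* What remains is (1 - u)^(-1/2) <= 1 + u / 2 + u^2 for |u| <= 1/2. *)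
have p0 : 0 <= 1 + u / 2 + u ^+ 2 by nra.
rewrite -ler_sqr ?nnegrE ?sqrtr_ge0// sqr_sqrtr; last by rewrite invr_ge0; lra.
rewrite -[_^-1]mul1r ler_pdivrMr; last lra.
have -> : (1 + u / 2 + u ^+ 2) ^+ 2 * (1 - u) =
  1 + u ^+ 2 * (5 / 4 - 5 / 4 * u - u * u ^+ 2) by field.
rewrite lerDl mulr_ge0 ?sqr_ge0//.
have u3 : u ^+ 2 <= 4^-1 by nra.
have := sqr_ge0 u; nra.
Qed.

End gaussian_moments.

(** * Measures given by densities *)

Section density_measures.
Context {R : realType} {n : nat}.
Variable p : 'rV[R]_n -> R.
Hypotheses (mp : measurable_fun setT p) (p0 : forall v, 0 <= p v).
Local Notation mu := (@lebesgue_rV R n).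

Let nu := density_measure p.

Let nu0 : nu set0 = 0%E.
Proof. by rewrite /nu /density_measure integral_set0. Qed.

Let nu_ge0 A : (0 <= nu A)%E.
Proof. by apply: integral_ge0 => v _; rewrite lee_fin. Qed.

Let nu_sigma_additive : semi_sigma_additive nu.
Proof.
move=> F mF tF mUF; rewrite /nu /density_measure ge0_integral_bigcup//; last 2 first.
- exact/measurable_EFinP/(measurable_funS measurableT).
- by move=> v _; rewrite lee_fin.
apply: is_cvg_ereal_nneg_natsum_cond => k _ _.
by apply: integral_ge0 => v _; rewrite lee_fin.
Qed.

Definition density_measure_pack : {measure set 'rV[R]_n -> \bar R} :=
  HB.pack nu (isMeasure.Build _ _ _ nu nu0 nu_ge0 nu_sigma_additive).

Import HBNNSimple.

Lemma ge0_integral_density (f : 'rV[R]_n -> \bar R) :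
  measurable_fun setT f -> (forall v, 0 <= f v)%E ->
  (\int[density_measure p]_v f v = \int[mu]_v (f v * (p v)%:E))%E.
Proof.
move=> mf f0; rewrite -[density_measure p]/(density_measure_pack : set _ -> \bar R).
have mpE : measurable_fun setT (EFin \o p) by exact/measurable_EFinP.
pose h := nnsfun_approx measurableT mf.
have hf v : (fun k => (h k v)%:E) @ \oo --> f v.
  by apply: cvg_nnsfun_approx.
have -> : (\int[density_measure_pack]_v f v)%E =
    limn (fun k => \int[density_measure_pack]_v (h k v)%:E)%E.
  under eq_integral => v _ do rewrite -(cvg_lim _ (hf v))//.
  apply: monotone_convergence => //.
  - by move=> k; exact/measurable_EFinP/measurable_funP.
  - by move=> k v _; rewrite lee_fin.
  - by move=> v _ a b ab; rewrite lee_fin; exact/lefP/nd_nnsfun_approx.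
have -> : (\int[mu]_v (f v * (p v)%:E))%E =
    limn (fun k => \int[mu]_v ((h k v)%:E * (p v)%:E))%E.
  have hfp v : (fun k => (h k v)%:E * (p v)%:E)%E @ \oo --> (f v * (p v)%:E)%E.
    by apply: cvgeZr => //; exact: hf.
  under eq_integral => v _ do rewrite -(cvg_lim _ (hfp v))//.
  apply: monotone_convergence => //.
  - by move=> k; apply: emeasurable_funM => //; exact/measurable_EFinP/measurable_funP.
  - by move=> k v _; rewrite mule_ge0 ?lee_fin.
  - move=> v _ a b ab; rewrite lee_wpmul2r ?lee_fin//; exact/lefP/nd_nnsfun_approx.
congr (limn _); apply/funext => k.
rewrite integralT_nnsfun sintegralE.
under eq_integral => v _.
  rewrite fimfunE -fsumEFin// ge0_mule_fsuml; last by move=> y; exact: nnfun_muleindic_ge0.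
  over.
rewrite ge0_integral_fsum//; last 2 first.
- move=> y; apply: emeasurable_funM => //; apply/measurable_EFinP.
  exact: measurable_funM.
- by move=> y v _; apply: mule_ge0; [exact: nnfun_muleindic_ge0|rewrite lee_fin].
apply: eq_fsbigr => r rh.
have r0 : (0 <= r)%R by have [v _ <-] := set_mem rh.
under eq_integral do rewrite EFinM -muleA.
rewrite ge0_integralZl_EFin//; last 2 first.
- by move=> v _; rewrite mule_ge0// lee_fin.
- by apply: emeasurable_funM => //; exact/measurable_EFinP.
congr (_ * _)%E; rewrite /= /nu /density_measure integral_mkcond.
apply: eq_integral => v _; rewrite patchE indicE.
by case: ifP => _; rewrite ?mul1e ?mul0e.
Qed.

Lemma integral_density (f : 'rV[R]_n -> R) : measurable_fun setT f ->
  (\int[density_measure p]_v (f v)%:E = \int[mu]_v (f v * p v)%:E)%E.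
Proof.
move=> mf; have mfE : measurable_fun setT (EFin \o f) by exact/measurable_EFinP.
rewrite -[density_measure p]/(density_measure_pack : set _ -> \bar R).
rewrite [LHS]integralE [RHS]integralE !ge0_integral_density//; last 2 first.
- exact: measurable_funeneg.
- exact: measurable_funepos.
congr (_ - _)%E; apply: eq_integral => v _.
- by rewrite !funeposE -!EFin_max -EFinM maxr_pMl// mul0r.
- by rewrite !funenegE -!EFinN -!EFin_max -EFinM maxr_pMl// mul0r mulNr.
Qed.

End density_measures.

(** * Multiplicative perturbations of Gaussian densities *)

Section log_closeness.
Context {R : realType}.

Definition weight n (v : 'rV[R]_n) : R := 1 + enorm v ^+ 2.

Lemma weight_ge1 n (v : 'rV[R]_n) : 1 <= weight v.
Proof. by rewrite lerDl sqr_ge0. Qed.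

Lemma weight_ge0 n (v : 'rV[R]_n) : 0 <= weight v.
Proof. exact: le_trans (weight_ge1 v). Qed.

Lemma measurable_weight n : measurable_fun setT (@weight n).
Proof.
rewrite (_ : @weight n = fun v => 1 + dot v v).
  by apply: measurable_funD => //; exact: measurable_dot.
by apply/funext => v; rewrite /weight enorm_sqr.
Qed.

(** Two densities are compared through their ratio, with a logarithm allowed
    to grow quadratically: such comparisons are stable under products and
    under averaging, and a small quadratic exponent does not destroy the
    integrability of a Gaussian. *)
Definition log_close n (tau : R) (f g : 'rV[R]_n -> R) :=
  forall v, expR (- (tau * weight v)) * g v <= f v <= expR (tau * weight v) * g v.

Lemma expRB1_le (x : R) : expR x - 1 <= x * expR x.
Proof.
have := expR_ge1Dx (- x); have := expR_gt0 x.
have : expR x * expR (- x) = 1 by rewrite -expRD subrr expR0.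
move: (expR x) (expR (- x)) => a b ab a0 h.
have : a * (1 - x) <= 1 by rewrite -{2}ab ler_pM2l.
lra.
Qed.

Lemma log_close_dist n tau (f g : 'rV[R]_n -> R) v : 0 <= tau -> 0 <= g v ->
  log_close tau f g -> `|f v - g v| <= (expR (tau * weight v) - 1) * g v.
Proof.
move=> t0 g0 /(_ v)/andP[h1 h2].
rewrite ler_norml mulrBl mul1r opprB; apply/andP; split; last by rewrite lerD2r.
suff : (2 - expR (tau * weight v)) * g v <= expR (- (tau * weight v)) * g v by lra.
rewrite ler_wpM2r//.
have : expR (tau * weight v) * expR (- (tau * weight v)) = 1 by rewrite -expRD subrr expR0.
have := expR_gt0 (tau * weight v); move: (expR _) (expR (- _)) => a b a0 ab.
have := sqr_ge0 (a - 1); rewrite -(ler_pM2l a0) ab; nra.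
Qed.

(** For t0 small, weight^2 e^(t0 weight) times the density is at most a multiple
    of a Gaussian kernel with half the precision; it dominates the first
    integrand, and tau times it dominates the second because
    e^x - 1 <= x e^x. *)
Lemma gauss_weight_bounds n (m : 'rV[R]_n) (S : 'M[R]_n) : spd S ->
  exists K t0 : R, [/\ 0 < K, 0 < t0,
    (\int[lebesgue_rV n]_v (weight v * gauss_pdf m S v)%:E <= K%:E)%E &
    forall tau, 0 <= tau <= t0 ->
      (\int[lebesgue_rV n]_v
         (weight v * (expR (tau * weight v) - 1) * gauss_pdf m S v)%:E <= (tau * K)%:E)%E].
Proof.
move=> hS; have hQ := spd_inv hS; have [l l0 lQ] := spd_coercive hQ.
set Q := invmx S in hQ lQ.
pose q (v : 'rV[R]_n) := dot ((v - m) *m Q) (v - m).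
pose A : R := 1 + 2 * enorm m ^+ 2; pose t0 := l / 16.
have t00 : 0 < t0 by rewrite divr_gt0.
(* The exponent 2 t0 costs at most half of the Gaussian exponent. *)
have wq v : 2 * t0 * weight v <= 2 * t0 * A + 4^-1 * q v.
  have := enormB_sqr (v - m) (- m); rewrite opprK subrK enormN.
  have := lQ (v - m); rewrite -/(q v) /t0 /weight /A; nra.
set c := (Num.sqrt ((2 * pi) ^+ n * \det S))^-1.
have c0 : 0 < c.
  by rewrite invr_gt0 sqrtr_gt0 mulr_gt0 ?det_spd_gt0// exprn_gt0// mulr_gt0// pi_gt0.
have hQ2 : spd (2^-1 *: Q) by apply: spdZ.
set Z := Num.sqrt ((2 * pi) ^+ n / \det (2^-1 *: Q)).
have Z0 : 0 < Z.
  by rewrite sqrtr_gt0 divr_gt0 ?det_spd_gt0// exprn_gt0// mulr_gt0// pi_gt0.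
pose D := 4 / t0 ^+ 2 * expR (2 * t0 * A) * c.
have D0 : 0 < D by rewrite !mulr_gt0 ?expR_gt0// invr_gt0 exprn_gt0.
have Dp : 0 < 4 / t0 ^+ 2 * c.
  by apply: mulr_gt0 => //; rewrite divr_gt0 ?exprn_gt0.
have w2 v : weight v ^+ 2 * expR (t0 * weight v) * gauss_pdf m S v <=
    D * gauss_kernel (2^-1 *: Q) m v.
  have h : weight v ^+ 2 <= 4 / t0 ^+ 2 * expR (t0 * weight v).
    have h1 : t0 / 2 * weight v <= expR (t0 / 2 * weight v).
      by have := expR_ge1Dx (t0 / 2 * weight v); lra.
    have : (t0 / 2 * weight v) ^+ 2 <= expR (t0 / 2 * weight v) ^+ 2.
      by rewrite ler_sqr ?nnegrE ?expR_ge0// mulr_ge0 ?weight_ge0// divr_ge0// ltW.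
    rewrite [leRHS]expr2 -expRD -mulrDl -splitr => h2.
    rewrite -ler_pdivrMl ?divr_gt0 ?exprn_gt0// invf_div; apply: le_trans h2.
    by rewrite le_eqVlt; apply/orP; left; apply/eqP; field.
  rewrite gauss_pdfE// -/c -/Q.
  apply: (@le_trans _ _ (4 / t0 ^+ 2 * expR (t0 * weight v) * expR (t0 * weight v)
                         * (c * gauss_kernel Q m v))).
    by rewrite ler_wpM2r ?mulr_ge0 ?expR_ge0 ?(ltW c0)// ler_wpM2r ?expR_ge0.
  have -> : D * gauss_kernel (2^-1 *: Q) m v = 4 / t0 ^+ 2 * c *
      (expR (2 * t0 * A) * gauss_kernel (2^-1 *: Q) m v) by rewrite /D; ring.
  rewrite -[leLHS]mulrA -[leLHS]mulrA [leLHS](_ : _ = 4 / t0 ^+ 2 * c *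
      (expR (t0 * weight v) * expR (t0 * weight v) * gauss_kernel Q m v)); last by ring.
  rewrite (ler_pM2l Dp).
  rewrite /gauss_kernel -!expRD ler_expR -scalemxAr dotZl -/(q v).
  by have := wq v; lra.
have iD : (\int[lebesgue_rV n]_v (D * gauss_kernel (2^-1 *: Q) m v)%:E = (D * Z)%:E)%E.
  under eq_integral do rewrite EFinM.
  rewrite ge0_integralZl_EFin ?(ltW D0)//.
  - by rewrite integral_gauss_kernel.
  - by move=> v _; rewrite lee_fin expR_ge0.
  - by apply/measurable_EFinP; exact: (@measurable_gauss_kernel _ _ _ _ _ (cst m) id).
have mw := @measurable_weight n.
have mD : measurable_fun setT (fun v => (D * gauss_kernel (2^-1 *: Q) m v)%:E).
  apply/measurable_EFinP; apply: measurable_funM => //.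
  exact: (@measurable_gauss_kernel _ _ _ _ _ (cst m) id).
clearbody D Z.
exists (D * Z), t0; split => //; first by rewrite mulr_gt0.
  rewrite -iD; apply: ge0_le_integral => //.
  - by move=> v _; rewrite lee_fin mulr_ge0 ?weight_ge0 ?gauss_pdf_ge0.
  - apply/measurable_EFinP; apply: measurable_funM => //.
    exact: measurable_gauss_pdf.
  move=> v _; rewrite lee_fin; apply: le_trans (w2 v).
  rewrite ler_wpM2r ?gauss_pdf_ge0// expr2 -mulrA ler_peMr ?weight_ge0//.
  rewrite -[leLHS]mulr1 ler_pM// ?weight_ge1// -expR0 ler_expR.
  by rewrite mulr_ge0 ?weight_ge0// ltW.
move=> tau /andP[tau0 taut0].
have -> : (tau * (D * Z))%:E =
    (\int[lebesgue_rV n]_v (tau%:E * (D * gauss_kernel (2^-1 *: Q) m v)%:E))%E.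
  rewrite ge0_integralZl_EFin ?iD// => v _.
  by rewrite lee_fin mulr_ge0 ?expR_ge0 ?(ltW D0).
have e0 v : 0 <= expR (tau * weight v) - 1.
  by rewrite subr_ge0 -expR0 ler_expR mulr_ge0 ?weight_ge0.
apply: ge0_le_integral => //.
- by move=> v _; rewrite lee_fin !mulr_ge0 ?weight_ge0 ?gauss_pdf_ge0.
- apply/measurable_EFinP; apply: measurable_funM; last exact: measurable_gauss_pdf.
  apply: measurable_funM => //; apply: measurable_funB => //.
  by apply: measurableT_comp => //; apply: measurable_funM.
- by apply: emeasurable_funM.
move=> v _; rewrite -EFinM lee_fin; apply: le_trans (ler_wpM2l tau0 (w2 v)).
rewrite [leRHS]mulrA ler_wpM2r ?gauss_pdf_ge0//.
apply: (@le_trans _ _ (weight v * (tau * weight v * expR (tau * weight v)))).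
  by rewrite ler_wpM2l ?weight_ge0// expRB1_le.
rewrite (_ : weight v * _ = tau * (weight v ^+ 2 * expR (tau * weight v))); last by ring.
rewrite ler_wpM2l// ler_wpM2l ?sqr_ge0// ler_expR ler_wpM2r//.
exact: weight_ge0.
Qed.

Lemma ge0_bounded_integrable d (T : measurableType d) (mu : {measure set T -> \bar R})
    (f : T -> R) (W : R) : measurable_fun setT f -> (forall v, 0 <= f v) ->
  (\int[mu]_v (f v)%:E <= W%:E)%E -> mu.-integrable setT (EFin \o f).
Proof.
move=> mf f0 fW; apply/integrableP; split; first exact/measurable_EFinP.
under eq_integral => v _ do rewrite /= ger0_norm//.
exact: le_lt_trans fW (ltry _).
Qed.

Section weighted_distance.
Variables (n : nat) (p rho : 'rV[R]_n -> R) (W e : R).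
Hypotheses (mp : measurable_fun setT p) (mrho : measurable_fun setT rho).
Hypothesis rho0 : forall v, 0 <= rho v.
Local Notation mu := (@lebesgue_rV R n).
Hypothesis rhoW : (\int[mu]_v (weight v * rho v)%:E <= W%:E)%E.
Hypothesis prho : (\int[mu]_v (weight v * `|p v - rho v|)%:E <= e%:E)%E.

(** The test functions of the metric and of the first two moments all grow at
    most quadratically, so they are covered by one bound. *)
Lemma expectation_close (phi : 'rV[R]_n -> R) (c : R) :
  measurable_fun setT phi -> 0 <= c -> (forall v, `|phi v| <= c * weight v) ->
  [/\ mu.-integrable setT (fun v => (phi v * p v)%:E),
      mu.-integrable setT (fun v => (phi v * rho v)%:E) &
      `|\int[mu]_v (phi v * p v) - \int[mu]_v (phi v * rho v)| <= c * e].
Proof.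
move=> mphi c0 phic; have mw := @measurable_weight n.
have md : measurable_fun setT (fun v => p v - rho v) by exact: measurable_funB.
have mwd : measurable_fun setT (fun v => weight v * `|p v - rho v|).
  by apply: measurable_funM => //; apply: measurableT_comp.
have i1 : mu.-integrable setT (fun v => (phi v * rho v)%:E).
  have iw : mu.-integrable setT (EFin \o (fun v => weight v * rho v)).
    apply: ge0_bounded_integrable rhoW; first exact: measurable_funM.
    by move=> v; rewrite mulr_ge0 ?weight_ge0.
  apply: (le_integrable measurableT _ _ (integrableZl measurableT c iw)).
    by apply/measurable_EFinP; exact: measurable_funM.
  move=> v _ /=; rewrite lee_fin !normrM (ger0_norm c0) mulrA.
  by rewrite ler_wpM2r// (ger0_norm (weight_ge0 v)).
have iwd : mu.-integrable setT (EFin \o (fun v => weight v * `|p v - rho v|)).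
  by apply: ge0_bounded_integrable prho => // v; rewrite mulr_ge0 ?weight_ge0.
have i2 : mu.-integrable setT (fun v => (phi v * (p v - rho v))%:E).
  apply: (le_integrable measurableT _ _ (integrableZl measurableT c iwd)).
    by apply/measurable_EFinP; exact: measurable_funM.
  move=> v _ /=; rewrite lee_fin !normrM (ger0_norm c0) mulrA normr_id.
  by rewrite ler_wpM2r// (ger0_norm (weight_ge0 v)).
have i3 : mu.-integrable setT (fun v => (phi v * p v)%:E).
  apply: eq_integrable (integrableD measurableT i1 i2) => // v _.
  by rewrite -EFinD -mulrDr addrC subrK.
split=> //; rewrite -RintegralB//.
under eq_Rintegral do rewrite -mulrBr.
rewrite -lee_fin EFin_normr_Rintegral//.
apply: le_trans (le_abse_integral mu measurableT (measurable_int _ i2)) _.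
apply: (@le_trans _ _ (\int[mu]_v (c%:E * (weight v * `|p v - rho v|)%:E))%E).
  apply: ge0_le_integral => //.
  - by apply: measurableT_comp => //; exact: measurable_int i2.
  - by apply: emeasurable_funM => //; exact/measurable_EFinP.
  by move=> v _; rewrite /= lee_fin normrM mulrA ler_wpM2r.
rewrite ge0_integralZl_EFin//.
- by rewrite EFinM lee_pmul// integral_ge0// => v _; rewrite lee_fin mulr_ge0// weight_ge0.
- by move=> v _; rewrite lee_fin mulr_ge0// weight_ge0.
- exact/measurable_EFinP.
Qed.

End weighted_distance.

Lemma gauss_log_close_dist n (m : 'rV[R]_n) (S : 'M[R]_n) : spd S ->
  exists K t0 : R, [/\ 0 < K, 0 < t0,
    (\int[lebesgue_rV n]_v (weight v * gauss_pdf m S v)%:E <= K%:E)%E &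
    forall tau f, 0 <= tau <= t0 -> measurable_fun setT f ->
      log_close tau f (gauss_pdf m S) ->
      (\int[lebesgue_rV n]_v (weight v * `|f v - gauss_pdf m S v|)%:E <= (tau * K)%:E)%E].
Proof.
move=> hS; have [K [t0 [K0 t00 KW Ktau]]] := gauss_weight_bounds m hS.
have mrho := measurable_gauss_pdf m hS; have mw := @measurable_weight n.
exists K, t0; split => // tau f /andP[tau0 taut0] mf fc.
apply: le_trans (Ktau tau _); last by rewrite tau0.
apply: ge0_le_integral => //.
- by move=> v _; rewrite lee_fin mulr_ge0 ?weight_ge0.
- apply/measurable_EFinP; apply: measurable_funM => //; apply: measurableT_comp => //.
  exact: measurable_funB.
- apply/measurable_EFinP; apply: measurable_funM => //.
  apply: measurable_funM => //; apply: measurable_funB => //.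
  by apply: measurableT_comp => //; apply: measurable_funM.
move=> v _; rewrite lee_fin -mulrA ler_wpM2l ?weight_ge0//.
by apply: log_close_dist => //; exact: gauss_pdf_ge0.
Qed.

(** Bayesian normalisation is Lipschitz at a Gaussian: f / A is O(tau)-close to
    the Gaussian in weighted L1, hence has mass 1 + O(tau), and dividing by this
    mass costs another O(tau). *)
Lemma normalization_close n (m : 'rV[R]_n) (S : 'M[R]_n) : spd S ->
  exists K t0 : R, [/\ 0 < K, 0 < t0,
    (\int[lebesgue_rV n]_v (weight v * gauss_pdf m S v)%:E <= K%:E)%E &
    forall tau A (f : 'rV[R]_n -> R), 0 <= tau <= t0 -> 0 < A ->
      measurable_fun setT f ->
      log_close tau f (fun v => A * gauss_pdf m S v) ->
      let N := fine (\int[lebesgue_rV n]_v (f v)%:E)%E in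
      [/\ 0 < N, (\int[lebesgue_rV n]_v (f v)%:E = N%:E)%E &
        (\int[lebesgue_rV n]_v (weight v * `|f v / N - gauss_pdf m S v|)%:E
           <= (tau * K)%:E)%E]].
Proof.
move=> hS; have [K [t0 [K0 t00 KW Ktau]]] := gauss_log_close_dist m hS.
have mrho := measurable_gauss_pdf m hS; have rho0 := gauss_pdf_ge0 m hS.
have mw := @measurable_weight n.
set rho := gauss_pdf m S in KW Ktau mrho rho0 *.
(* tau K <= 1/2 keeps the mass of f / A above 1/2. *)
pose t1 := Num.min t0 (Num.min 1 (2 * K)^-1).
have t10 : 0 < t1 by rewrite !lt_min t00 ltr01 invr_gt0 mulr_gt0.
pose K1 := 4 * K ^+ 2 + K; have K1K : K <= K1 by rewrite lerDr mulr_ge0 ?sqr_ge0.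
exists K1, t1; split => //; first exact: lt_le_trans K1K.
  by apply: le_trans KW _; rewrite lee_fin.
move=> tau A f /andP[tau0]; rewrite !le_min => /and3P[taut0 tau1 tauK] A0 mf fA.
have {}tauK : tau * K <= 2^-1.
  by rewrite -ler_pdivlMr// -invfM.
pose g v := f v / A.
have mg : measurable_fun setT g by exact: measurable_funM.
have gc : log_close tau g rho.
  move=> v; have /andP[h1 h2] := fA v.
  by rewrite /g ler_pdivlMr// ler_pdivrMr// -!(mulrA _ (rho v)) (mulrC (rho v)) h1 h2.
have g0 v : 0 <= g v.
  by have /andP[+ _] := gc v; apply: le_trans; rewrite mulr_ge0 ?expR_ge0.
have gd : (\int[lebesgue_rV n]_v (weight v * `|g v - rho v|)%:E <= (tau * K)%:E)%E.
  by apply: Ktau => //; rewrite tau0.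
have one_le (v : 'rV[R]_n) : `|1 : R| <= 1 * weight v by rewrite normr1 mul1r weight_ge1.
have weight_le (v : 'rV[R]_n) : `|weight v| <= 1 * weight v.
  by rewrite mul1r ger0_norm ?weight_ge0.
have [ig1 ir1 D1] := expectation_close mg mrho rho0 KW gd
  (measurable_cst (1 : R)) ler01 one_le.
have [igw irw Dw] := expectation_close mg mrho rho0 KW gd mw ler01
  weight_le.
pose M := \int[lebesgue_rV n]_v g v.
have ig : (lebesgue_rV n).-integrable setT (EFin \o g).
  by apply: eq_integrable ig1 => // v _; rewrite mul1r.
have ME : (\int[lebesgue_rV n]_v (g v)%:E = M%:E)%E.
  by rewrite fineK//; exact: integrable_fin_num.
have M1 : `|M - 1| <= tau * K.
  move: D1; under eq_Rintegral do rewrite mul1r.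
  under [X in _ - X]eq_Rintegral do rewrite mul1r.
  by rewrite mul1r /Rintegral integral_gauss_pdf.
have M2 : 2^-1 <= M by move: M1; rewrite ler_norml => /andP[h _]; lra.
have M0 : 0 < M by apply: lt_le_trans M2; rewrite invr_gt0.
have NE : (\int[lebesgue_rV n]_v (f v)%:E = (A * M)%:E)%E.
  rewrite EFinM -ME -integralZl//; apply: eq_integral => v _.
  by rewrite -EFinM /g mulrC divfK ?gt_eqF.
move=> N; rewrite /N NE /=; split => //; first by rewrite mulr_gt0.
have wg : (\int[lebesgue_rV n]_v (weight v * g v)%:E <= (2 * K)%:E)%E.
  rewrite -(fineK (integrable_fin_num _ igw))// lee_fin.
  have h : \int[lebesgue_rV n]_v (weight v * rho v) <= K.
    by rewrite -lee_fin fineK//; exact: integrable_fin_num.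
  have := le_trans (ler_norm _) Dw.
  rewrite mul1r lerBlDr => /le_trans; apply; rewrite mulrDl mul1r.
  apply: lerD h; apply: ler_piMl => //; exact: ltW.
have MV : `|M^-1 - 1| <= 2 * (tau * K).
  have -> : M^-1 - 1 = (1 - M) * M^-1 by rewrite mulrBl mul1r divff ?gt_eqF.
  rewrite normrM distrC mulrC ler_pM// gtr0_norm ?invr_gt0//.
  by rewrite -[leRHS]invrK lef_pV2 ?posrE ?invr_gt0.
have wgi : (0 <= \int[lebesgue_rV n]_v (weight v * g v)%:E)%E.
  by apply: integral_ge0 => v _; rewrite lee_fin mulr_ge0 ?weight_ge0.
have mwg : measurable_fun setT (fun v => (weight v * g v)%:E).
  by apply/measurable_EFinP; exact: measurable_funM.
have mgr : measurable_fun setT (fun v => (weight v * `|g v - rho v|)%:E).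
  apply/measurable_EFinP; apply: measurable_funM => //.
  by apply: measurableT_comp => //; exact: measurable_funB.
apply: (@le_trans _ _ (\int[lebesgue_rV n]_v (`|M^-1 - 1|%:E * (weight v * g v)%:E +
    (weight v * `|g v - rho v|)%:E))%E).
  apply: ge0_le_integral => //.
  - by move=> v _; rewrite lee_fin mulr_ge0 ?weight_ge0.
  - apply/measurable_EFinP; apply: measurable_funM => //.
    by apply: measurableT_comp => //; apply: measurable_funB => //; apply: measurable_funM.
  - by apply: emeasurable_funD => //; apply: emeasurable_funM.
  move=> v _; rewrite -EFinM -EFinD lee_fin mulrCA -mulrDr ler_wpM2l ?weight_ge0//.
  have -> : f v / (A * M) - rho v = (M^-1 - 1) * g v + (g v - rho v).
    by rewrite /g; field; rewrite !gt_eqF.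
  by apply: le_trans (ler_normD _ _) _; rewrite normrM (ger0_norm (g0 v)).
rewrite ge0_integralD//.
- rewrite ge0_integralZl_EFin//; last by move=> v _; rewrite lee_fin mulr_ge0 ?weight_ge0.
  apply: (@le_trans _ _ ((2 * (tau * K))%:E * (2 * K)%:E + (tau * K)%:E)%E).
    by apply: leeD => //; apply: lee_pmul; rewrite ?lee_fin.
  by rewrite -EFinM -EFinD lee_fin /K1; lra.
- by move=> v _; apply: mule_ge0; rewrite lee_fin ?normr_ge0// mulr_ge0 ?weight_ge0.
- by apply: emeasurable_funM.
- by move=> v _; rewrite lee_fin mulr_ge0 ?weight_ge0.
Qed.
End log_closeness.

(** * Mean and covariance of perturbed Gaussians *)

Section has_integral.
Context {R : realType} {d : measure_display} {T : measurableType d}.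
Variable mu : {measure set T -> \bar R}.

Definition has_integral (f : T -> R) (x : R) :=
  mu.-integrable setT (EFin \o f) /\ (\int[mu]_v (f v)%:E = x%:E)%E.

Lemma has_integralD f g x y : has_integral f x -> has_integral g y ->
  has_integral (fun v => f v + g v) (x + y).
Proof.
move=> [fi fx] [gi gy]; split.
  by apply: eq_integrable (integrableD measurableT fi gi).
by under eq_integral do rewrite EFinD; rewrite integralD// fx gy.
Qed.

Lemma has_integralZ a f x : has_integral f x ->
  has_integral (fun v => a * f v) (a * x).
Proof.
move=> [fi fx]; split.
  by apply: eq_integrable (integrableZl measurableT a fi).
by under eq_integral do rewrite EFinM; rewrite integralZl// fx.
Qed.

Lemma eq_has_integral f g x y : f =1 g -> x = y -> has_integral f x -> has_integral g y.
Proof. by move=> /funext -> ->. Qed.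

Lemma has_integral_Rintegral f x : has_integral f x -> \int[mu]_v f v = x.
Proof. by rewrite /Rintegral => -[_ ->]. Qed.

End has_integral.

Section perturbed_moments.
Context {R : realType} {n : nat}.
Variables (m : 'rV[R]_n) (S : 'M[R]_n).
Hypothesis hS : spd S.
Local Notation rho := (gauss_pdf m S).
Local Notation mu := (@lebesgue_rV R n).

Let has_mass : has_integral mu rho 1.
Proof.
split; last exact: integral_gauss_pdf.
apply: (@ge0_bounded_integrable _ _ _ mu rho 1).
- exact: measurable_gauss_pdf.
- exact: gauss_pdf_ge0.
- by rewrite integral_gauss_pdf.
Qed.

Let has_mean i : has_integral mu (fun v => (v ord0 i - m ord0 i) * rho v) 0.
Proof.
have [h1 h2] := gauss_moment1 m hS (delta_mx ord0 i).
have E v : dot (v - m) (delta_mx ord0 i) = v ord0 i - m ord0 i.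
  by rewrite dot_delta !mxE.
suff : has_integral mu (fun v => dot (v - m) (delta_mx ord0 i) * rho v) 0.
  by apply: eq_has_integral => // v; rewrite E.
by split.
Qed.

Lemma gauss_mean i : has_integral mu (fun v => v ord0 i * rho v) (m ord0 i).
Proof.
apply: eq_has_integral (has_integralD (has_mean i) (has_integralZ (m ord0 i) has_mass)).
  by move=> v; ring.
by rewrite add0r mulr1.
Qed.

(** The covariance about an arbitrary centre b, by polarisation of the
    second moments along delta_i, delta_j and delta_i + delta_j. *)
Lemma gauss_covariance (b : 'rV[R]_n) i j :
  has_integral mu (fun v => (v ord0 i - b ord0 i) * (v ord0 j - b ord0 j) * rho v)
    (S i j + (m ord0 i - b ord0 i) * (m ord0 j - b ord0 j)).
Proof.
pose X a (v : 'rV[R]_n) := dot (v - m) a ^+ 2 * rho v.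
have hX a : has_integral mu (X a) (dot (a *m S) a) by exact: gauss_moment2.
pose e k : 'rV[R]_n := delta_mx ord0 k.
have Xe v k : dot (v - m) (e k) = v ord0 k - m ord0 k by rewrite dot_delta !mxE.
have Se k l : dot (e k *m S) (e l) = S k l by rewrite dot_delta -rowE mxE.
have Sji : S j i = S i j by rewrite -{1}hS.1 mxE.
have := has_integralD
  (has_integralD (has_integralZ 2^-1 (hX (e i + e j)))
    (has_integralD (has_integralZ (- 2^-1) (hX (e i))) (has_integralZ (- 2^-1) (hX (e j)))))
  (has_integralD
    (has_integralD (has_integralZ (m ord0 j - b ord0 j) (has_mean i))
      (has_integralZ (m ord0 i - b ord0 i) (has_mean j)))
    (has_integralZ ((m ord0 i - b ord0 i) * (m ord0 j - b ord0 j)) has_mass)).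
apply: eq_has_integral => [v|]; first by rewrite /X dotDr !Xe; field.
by rewrite mulmxDl dotDl !dotDr !Se Sji; field.
Qed.

(** The mean b of f is close to m by [expectation_close]; the covariance of f is
    then compared with the second moments of the Gaussian about b, which differ
    from S by the rank-one matrix (m - b)^T (m - b). *)
Lemma moments_close : exists C t0 : R, [/\ 0 < C, 0 < t0 &
  forall tau f, 0 <= tau <= t0 -> measurable_fun setT f -> log_close tau f rho ->
    (forall i, `|mean (density_measure f) ord0 i - m ord0 i| <= tau * C) /\
    (forall i j, `|covariance_mx (density_measure f) i j - S i j| <= tau * C)].
Proof.
have [K [t0 [K0 t00 KW Ktau]]] := gauss_log_close_dist m hS.
pose B := enorm m + K; pose C := K * (2 + 2 * B ^+ 2 + K + 1).
have B0 : 0 <= B by rewrite addr_ge0 ?enorm_ge0 ?(ltW K0).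
have C1 : 1 <= 2 + 2 * B ^+ 2 + K + 1 by have := sqr_ge0 B; lra.
exists C, (Num.min t0 1); split.
- by rewrite mulr_gt0//; lra.
- by rewrite lt_min t00 ltr01.
move=> tau f /andP[tau0]; rewrite le_min => /andP[taut0 tau1] mf fc.
have mrho := measurable_gauss_pdf m hS; have rho0 := gauss_pdf_ge0 m hS.
have f0 v : 0 <= f v.
  by have /andP[+ _] := fc v; apply: le_trans; rewrite mulr_ge0 ?expR_ge0.
have fd := Ktau tau f; rewrite tau0 taut0 in fd; have {}fd := fd isT mf fc.
have mco i : measurable_fun setT (fun v : 'rV[R]_n => v ord0 i) by exact: measurable_coord.
have mean1 i : `|mean (density_measure f) ord0 i - m ord0 i| <= tau * K.
  rewrite mxE integral_density//.
  have ub (v : 'rV[R]_n) : `|v ord0 i| <= 1 * weight v.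
    rewrite mul1r /weight; apply: le_trans (coord_le_enorm _ _) _.
    by have := sqr_ge0 (enorm v - 1); have := sqr_ge0 (enorm v); nra.
  have [_ _] := expectation_close mf mrho rho0 KW fd (mco i) ler01 ub.
  by rewrite (has_integral_Rintegral (gauss_mean i)) mul1r.
have tK : tau * K <= K by rewrite ler_piMl// ltW.
split=> [i|i j].
  apply: le_trans (mean1 i) _; rewrite /C mulrA ler_peMr//.
  by rewrite mulr_ge0// ltW.
rewrite mxE; set b := mean _.
have bB k : `|b ord0 k| <= B.
  have := mean1 k; have := coord_le_enorm m k.
  have := ler_normD (b ord0 k - m ord0 k) (m ord0 k); rewrite subrK /B -/b; lra.
have mphi : measurable_fun setT (fun v : 'rV[R]_n =>
    (v ord0 i - b ord0 i) * (v ord0 j - b ord0 j)).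
  by apply: measurable_funM; exact: measurable_funB.
rewrite integral_density//.
have ub (v : 'rV[R]_n) : `|(v ord0 i - b ord0 i) * (v ord0 j - b ord0 j)| <=
    (2 + 2 * B ^+ 2) * weight v.
  have h k : `|v ord0 k - b ord0 k| <= enorm v + B.
    by apply: le_trans (ler_normB _ _) _; rewrite lerD ?coord_le_enorm.
  rewrite normrM; apply: le_trans (ler_pM _ _ (h i) (h j)) _ => //.
  rewrite /weight; have := sqr_ge0 (enorm v - B).
  have := mulr_ge0 (sqr_ge0 B) (sqr_ge0 (enorm v)); nra.
have c0 : 0 <= 2 + 2 * B ^+ 2 by have := sqr_ge0 B; lra.
have [_ _] := expectation_close mf mrho rho0 KW fd mphi c0 ub.
rewrite (has_integral_Rintegral (gauss_covariance b i j)) -/(Rintegral _ _ _).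
set I := Rintegral _ _ _ => h.
have h2 : `|(m ord0 i - b ord0 i) * (m ord0 j - b ord0 j)| <= tau * K * K.
  rewrite normrM ler_pM// distrC; first exact: mean1.
  exact: le_trans (mean1 j) tK.
have := ler_normD (I - (S i j + (m ord0 i - b ord0 i) * (m ord0 j - b ord0 j)))
  ((m ord0 i - b ord0 i) * (m ord0 j - b ord0 j)).
rewrite opprD addrA subrK => /le_trans; apply.
apply: (@le_trans _ _ ((2 + 2 * B ^+ 2) * (tau * K) + tau * K * K)).
  by apply: lerD h2; move: h; rewrite opprD addrA.
have : 0 <= tau * K by rewrite mulr_ge0// ltW.
rewrite /C; nra.
Qed.

End perturbed_moments.

(** * The Gaussian projection of a perturbed Gaussian *)

Section gaussian_projection.
Context {R : realType} {n : nat}.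
Variables (m : 'rV[R]_n) (S : 'M[R]_n).
Hypothesis hS : spd S.

(** With D = m - m' and w = v - m, the difference of the exponents is the
    perturbation of the inverse covariance applied to w + D plus
    2 dot (w S^-1) D + dot (D S^-1) D, and each term is O(e (1 + |v|^2)). *)
Lemma gauss_kernel_perturb : exists C e0 : R, [/\ 0 < C, 0 < e0 &
  forall e (m' : 'rV[R]_n) (S' : 'M[R]_n), 0 <= e <= e0 -> S'^T = S' ->
    (forall i, `|m' ord0 i - m ord0 i| <= e) ->
    (forall i j, `|S' i j - S i j| <= e) ->
    spd S' /\
    log_close (e * C) (gauss_kernel (invmx S') m') (gauss_kernel (invmx S) m)].
Proof.
have [d0 [C1 [d00 C10 Cinv]]] := invmx_perturb hS.
pose N : R := n%:R; have N0 : 0 <= N by exact: ler0n.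
set sg := entry_sum (invmx S); have sg0 : 0 <= sg by exact: entry_sum_ge0.
set M := enorm m; have M0 : 0 <= M by exact: enorm_ge0.
pose C := C1 * N ^+ 2 * (2 + 2 * (M + N) ^+ 2) + 2 * sg * N * (1 + M) + sg * N ^+ 2.
have C0 : 0 <= C.
  have h1 : 0 <= 2 + 2 * (M + N) ^+ 2 by have := sqr_ge0 (M + N); lra.
  have h2 : 0 <= 2 * sg * N * (1 + M).
    by rewrite mulr_ge0 ?addr_ge0// mulr_ge0// mulr_ge0.
  by rewrite addr_ge0 ?mulr_ge0 ?sqr_ge0// addr_ge0// !mulr_ge0 ?sqr_ge0.
have N1 : 0 < N ^+ 2 + 1 by have := sqr_ge0 N; lra.
exists (C + 1), (Num.min 1 (d0 / (N ^+ 2 + 1))); split.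
- by rewrite ltr_wpDl.
- by rewrite lt_min ltr01 divr_gt0.
move=> e m' S' /andP[e0]; rewrite le_min => /andP[e1 ed] S't m'e S'e.
have DS : entry_sum (S' - S) <= N ^+ 2 * e.
  rewrite /entry_sum; apply: (@le_trans _ _ (\sum_(i < n) \sum_(j < n) e)).
    by apply: ler_sum => i _; apply: ler_sum => j _; rewrite !mxE.
  by rewrite !sumr_const !card_ord -mulrnA -mulr_natl natrM -expr2.
have DSd : entry_sum (S' - S) <= d0.
  apply: le_trans DS _; move: ed; rewrite ler_pdivlMr// mulrDr mulr1 mulrC; lra.
have [hS' qS'] := Cinv S' S't DSd; split => //.
move=> v; pose D := m - m'; pose w := v - m.
have vE : v - m' = w + D by rewrite /w /D addrA subrK.
have De : enorm D <= N * e.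
  apply: le_trans (enorm_le_sum _) _.
  apply: (@le_trans _ _ (\sum_(i < n) e)).
    by apply: ler_sum => i _; rewrite !mxE distrC.
  by rewrite sumr_const card_ord mulr_natl.
have m'M : enorm m' <= M + N.
  have -> : m' = m + - D by rewrite /D opprB addrC subrK.
  apply: le_trans (enormD _ _) _; rewrite enormN lerD2l.
  by apply: le_trans De _; rewrite ler_piMr.
have wM : enorm w <= enorm v + M by apply: le_trans (enormD _ _) _; rewrite enormN.
have v0 := enorm_ge0 v; have D0 := enorm_ge0 D; have w0 := enorm_ge0 w.
have m'0 := enorm_ge0 m'.
have key : `|dot ((v - m') *m invmx S') (v - m') - dot ((v - m) *m invmx S) (v - m)|
    <= e * C * weight v.
  have s1 := weight_ge1 v.
  have vs : enorm v <= weight v by rewrite /weight; have := sqr_ge0 (enorm v - 1); nra.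
  have h1 : `|dot ((v - m') *m invmx S') (v - m') - dot ((v - m') *m invmx S) (v - m')|
      <= e * (C1 * N ^+ 2 * (2 + 2 * (M + N) ^+ 2)) * weight v.
    apply: le_trans (qS' _) _.
    have g1 : enorm (v - m') ^+ 2 <= (2 + 2 * (M + N) ^+ 2) * weight v.
      apply: le_trans (enormB_sqr _ _) _.
      have : enorm m' ^+ 2 <= (M + N) ^+ 2 by rewrite ler_sqr ?nnegrE// addr_ge0.
      rewrite /weight; have := sqr_ge0 (enorm v); have := sqr_ge0 (M + N).
      move: (enorm v ^+ 2) (enorm m' ^+ 2) ((M + N) ^+ 2) => a b c ? ? ?; nra.
    have -> : e * (C1 * N ^+ 2 * (2 + 2 * (M + N) ^+ 2)) * weight v =
      C1 * (N ^+ 2 * e) * ((2 + 2 * (M + N) ^+ 2) * weight v) by ring.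
    apply: ler_pM g1; last exact: ler_wpM2l.
    - by rewrite mulr_ge0 ?entry_sum_ge0.
    - exact: sqr_ge0.
  have h2 : `|dot ((v - m') *m invmx S) (v - m') - dot (w *m invmx S) w|
      <= e * (2 * sg * N * (1 + M) + sg * N ^+ 2) * weight v.
    have -> : dot ((v - m') *m invmx S) (v - m') - dot (w *m invmx S) w =
        2 * dot (w *m invmx S) D + dot (D *m invmx S) D.
      rewrite vE; move: w D {De D0 wM w0 vE} => w D.
      rewrite mulmxDl !dotDl !dotDr (dot_sym D w (spd_inv hS).1); ring.
    apply: le_trans (ler_normD _ _) _; rewrite normrM (@ger0_norm _ 2)//.
    have g1 := dot_mulmx_le w (invmx S) D; have g2 := dot_mulmx_le D (invmx S) D.
    have g3 : enorm w <= (1 + M) * weight v.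
      by apply: le_trans wM _; rewrite mulrDl mul1r lerD// ler_peMr.
    have g4 : sg * enorm w * enorm D <= sg * ((1 + M) * weight v) * (N * e).
      by apply: ler_pM De; rewrite ?mulr_ge0// ler_wpM2l.
    have g5 : sg * enorm D * enorm D <= sg * (N * e) * (N * e).
      by apply: ler_pM => //; [exact: mulr_ge0|exact: ler_wpM2l].
    have g6 : sg * (N * e) * (N * e) <= e * (sg * N ^+ 2) * weight v.
      have -> : sg * (N * e) * (N * e) = (e * (sg * N ^+ 2)) * e by ring.
      rewrite ler_wpM2l ?mulr_ge0 ?sqr_ge0//; exact: le_trans e1 s1.
    rewrite -/sg in g1 g2; lra.
  have := ler_normD (dot ((v - m') *m invmx S') (v - m') - dot ((v - m') *m invmx S) (v - m'))
    (dot ((v - m') *m invmx S) (v - m') - dot (w *m invmx S) w).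
  rewrite addrA subrK => /le_trans; apply; rewrite /C; lra.
rewrite /gauss_kernel -!expRD !ler_expR.
move: key; rewrite ler_norml => /andP[k1 k2].
have : 0 <= e * weight v by rewrite mulr_ge0// weight_ge0.
have : 0 <= e * C * weight v by rewrite mulr_ge0 ?mulr_ge0 ?weight_ge0.
by move=> ? ?; apply/andP; split; lra.
Qed.

Lemma gauss_pdf_shift : exists C e0 : R, [/\ 0 < C, 0 < e0 &
  forall e m', 0 <= e <= e0 -> enorm (m' - m) <= e ->
    log_close (e * C) (gauss_pdf m' S) (gauss_pdf m S)].
Proof.
have [C [e0 [C0 e00 H]]] := gauss_kernel_perturb.
exists C, e0; split => // e m' ee me; have /andP[e_ge0 _] := ee.
have [|i j|_ Hc v] := H e m' S ee hS.1.
- move=> i; apply: le_trans me; have := coord_le_enorm (m' - m) i.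
  by rewrite !mxE.
- by rewrite subrr normr0.
rewrite !gauss_pdfE// ![expR _ * (_^-1 * _)]mulrCA !ler_pM2l ?Hc//.
all: by rewrite invr_gt0 sqrtr_gt0 mulr_gt0 ?det_spd_gt0// exprn_gt0// mulr_gt0// pi_gt0.
Qed.

End gaussian_projection.

(** The factor A is the ratio of the two normalising constants; a later Bayesian
    normalisation removes it. *)
Lemma gaussian_op_log_close (R : realType) (d K : nat) (m : 'rV[R]_(d + K))
    (S : 'M[R]_(d + K)) : spd S ->
  exists C t0 : R, [/\ 0 < C, 0 < t0 &
    forall tau f, 0 <= tau <= t0 -> measurable_fun setT f ->
      log_close tau f (gauss_pdf m S) ->
      measurable_fun setT (gaussian_op f) /\
      exists2 A, 0 < A &
        log_close (tau * C) (gaussian_op f) (fun v => A * gauss_pdf m S v)].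
Proof.
move=> hS; have [C1 [t1 [C10 t10 H1]]] := moments_close m hS.
have [C2 [e0 [C20 e00 H2]]] := gauss_kernel_perturb m hS.
exists (C1 * C2), (Num.min t1 (e0 / C1)); split.
- exact: mulr_gt0.
- by rewrite lt_min t10 divr_gt0.
move=> tau f /andP[tau0]; rewrite le_min => /andP[taut1 taue] mf fc.
have taut : 0 <= tau <= t1 by rewrite tau0.
have [hm hc] := H1 tau f taut mf fc.
have [||hS' kc] := H2 (tau * C1) _ _ _ _ hm hc.
- by rewrite mulr_ge0 ?(ltW C10)//= -ler_pdivlMr.
- apply/matrixP => i j; rewrite mxE [LHS]mxE [RHS]mxE; congr fine.
  by congr integral; apply/funext => v; rewrite mulrC.
split; first exact: measurable_gauss_pdf.
pose cst (T : 'M[R]_(d + K)) := Num.sqrt ((2 * pi) ^+ (d + K) * \det T).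
have cst0 T : spd T -> 0 < cst T.
  by move=> hT; rewrite sqrtr_gt0 mulr_gt0 ?det_spd_gt0// exprn_gt0// mulr_gt0// pi_gt0.
have c0 := cst0 _ hS; have c'0 := cst0 _ hS'.
exists (cst S / cst (covariance_mx (density_measure f))) => [|v].
  by rewrite divr_gt0.
rewrite /gaussian_op !gauss_pdfE// -!/(cst _).
rewrite (mulrA _ (cst S)^-1) [cst S / _ / _]mulrAC divff ?gt_eqF// mul1r.
by rewrite ![expR _ * (_^-1 * _)]mulrCA !ler_pM2l ?invr_gt0// mulrA kc.
Qed.

(** * One step of the filters *)

Lemma gauss_pdf_row_mx (R : realType) d K (a : 'rV[R]_d) (b : 'rV[R]_K)
    (S : 'M[R]_d) (T : 'M[R]_K) u y : spd S -> spd T ->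
  gauss_pdf (row_mx a b) (block_mx S 0 0 T) (row_mx u y) =
  gauss_pdf b T y * gauss_pdf a S u.
Proof.
move=> hS hT; have hB := spd_block hS hT.
rewrite !gauss_pdfE// invmx_block// det_ublock /gauss_kernel.
rewrite opp_row_mx add_row_mx mul_row_block !mulmx0 addr0 add0r dot_row_mx.
have pn k : 0 <= (2 * pi : R) ^+ k by rewrite exprn_ge0// mulr_ge0// pi_ge0.
have dS := det_spd_gt0 hS; have dT := det_spd_gt0 hT.
rewrite [- _^-1 * (_ + _)]mulrDr [expR (_ + _)]expRD exprD.
rewrite [_ ^+ d * _ * _]mulrACA sqrtrM; last by rewrite mulr_ge0 ?pn// ltW.
by rewrite invfM; ring.
Qed.

Lemma continuous_measurable_rV (R : realType) d K (h : 'rV[R]_d -> 'rV[R]_K) :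
  continuous h -> measurable_fun setT h.
Proof.
move=> /continuousP hc; apply: (measurability (@open 'rV[R]_K)) => // _ [U oU <-].
by rewrite setTI; apply: open_measurable_rV; exact: hc.
Qed.

Lemma probability_mean_bounds d (T : measurableType d) (R : realType)
    (P : probability T R) (f : T -> R) (a b : R) : measurable_fun setT f ->
  0 <= a -> (forall x, a <= f x <= b) -> a <= fine (\int[P]_x (f x)%:E) <= b.
Proof.
move=> mf a0 fab.
have cstE (r : R) : (\int[P]_x (r%:E) = r%:E)%E.
  by rewrite integral_cst//= probability_setT mule1.
have f0 x : 0 <= f x by apply: le_trans a0 _; case/andP: (fab x).
have h1 : (a%:E <= \int[P]_x (f x)%:E)%E.
  rewrite -(cstE a); apply: ge0_le_integral => //; first exact/measurable_EFinP.
  by move=> x _; rewrite lee_fin; case/andP: (fab x).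
have h2 : (\int[P]_x (f x)%:E <= b%:E)%E.
  rewrite -(cstE b); apply: ge0_le_integral => //; first by move=> x _; rewrite lee_fin.
    exact/measurable_EFinP.
  by move=> x _; rewrite lee_fin; case/andP: (fab x).
by move: h1 h2; case: (integral _ _ _) => //= r; rewrite !lee_fin => -> ->.
Qed.

Section near_gaussian_densities.
Context {R : realType} {d : nat}.
Variables (Sigma : 'M[R]_d) (c : 'rV[R]_d).
Hypothesis hSigma : spd Sigma.

(** The weighted L1 distance to N(c, Sigma) dominates the metric, whose test
    functions are bounded by the weight. *)
Definition near_gauss e (p : 'rV[R]_d -> R) :=
  [/\ measurable_fun setT p, (forall u, 0 <= p u),
      (\int[lebesgue_rV d]_u (p u)%:E = 1)%E &
      (\int[lebesgue_rV d]_u (weight u * `|p u - gauss_pdf c Sigma u|)%:E <= e%:E)%E].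

Lemma near_gauss_probability e p : near_gauss e p ->
  exists P : probability 'rV[R]_d R, density_measure p = P.
Proof.
move=> [mp p0 p1 _].
pose nu := density_measure_pack mp p0.
have nu1 : nu setT = 1%E by [].
pose P : probability 'rV[R]_d R :=
  HB.pack (nu : set _ -> \bar R) (Measure.class nu) (Measure_isProbability.Build _ _ _ nu nu1).
by exists P.
Qed.

(** The triangle inequality through N(c, Sigma): test functions dominated by
    the weight integrate against p1 and p2 up to the weighted distances. *)
Lemma dg_near_gauss e p1 p2 : near_gauss e p1 -> near_gauss e p2 ->
  (dg (density_measure p1) (density_measure p2) <= (2 * e)%:E)%E.
Proof.
move=> [m1 p10 _ d1] [m2 p20 _ d2]; apply: ub_ereal_sup => _ [g [mg gw] <-].
rewrite !integral_density//.
have [W [_ [_ _ rW _]]] := gauss_log_close_dist c hSigma.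
have mr := measurable_gauss_pdf c hSigma; have r0 := gauss_pdf_ge0 c hSigma.
have gw1 v : `|g v| <= 1 * weight v by rewrite mul1r; exact: gw.
have [i1 _ D1] := expectation_close m1 mr r0 rW d1 mg ler01 gw1.
have [i2 _ D2] := expectation_close m2 mr r0 rW d2 mg ler01 gw1.
rewrite -(fineK (integrable_fin_num _ i1))// -(fineK (integrable_fin_num _ i2))//.
rewrite -EFinB abse_EFin lee_fin -/(Rintegral _ _ _) -/(Rintegral _ _ _).
move: D1 D2; rewrite mul1r; set a := Rintegral _ _ _; set b := Rintegral _ _ _.
set r := Rintegral _ _ _ => D1 D2.
apply: le_trans (ler_distD b a r) _; rewrite (distrC b r); lra.
Qed.

End near_gaussian_densities.

Section filter_step.
Context {R : realType} {d K : nat}.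
Variables (Sigma : 'M[R]_d) (Gamma : 'M[R]_K).
Hypotheses (hSigma : spd Sigma) (hGamma : spd Gamma).
Variables (c : 'rV[R]_d) (c' : 'rV[R]_K).

(** Averaging the law of Psi(V) + noise over V: every Gaussian in the mixture
    is log-close to N(c, Sigma), with the same constant, hence so is the
    mixture, whatever the law of V. *)
Lemma prediction_close : exists C e0 : R, [/\ 0 < C, 0 < e0 &
  forall e (Psi : 'rV[R]_d -> 'rV[R]_d) (mu : probability 'rV[R]_d R), 0 <= e <= e0 ->
    measurable_fun setT Psi -> (forall v, enorm (Psi v - c) <= e) ->
    measurable_fun setT (prediction_op Psi Sigma mu) /\
    log_close (e * C) (prediction_op Psi Sigma mu) (gauss_pdf c Sigma)].
Proof.
have [C [e0 [C0 e00 H]]] := gauss_pdf_shift c hSigma.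
exists C, e0; split => // e Psi mu ee mPsi Psic; split.
  pose F (p : 'rV[R]_d * 'rV[R]_d) := (gauss_pdf (Psi p.1) Sigma p.2)%:E.
  apply: (@measurableT_comp _ _ _ _ _ _ fine _ (fubini_G mu F)) => //.
  apply: measurable_fun_fubini_tonelli_G => [|p]; last by rewrite lee_fin gauss_pdf_ge0.
  apply/measurable_EFinP; under eq_fun do rewrite gauss_pdfE//.
  apply: measurable_funM => //; apply: measurable_gauss_kernel => //.
  exact: measurableT_comp.
move=> v; apply: probability_mean_bounds.
- under eq_fun do rewrite gauss_pdfE//.
  apply: measurable_funM => //.
  exact: (@measurable_gauss_kernel _ _ _ _ _ Psi (cst v)).
- by rewrite mulr_ge0 ?expR_ge0 ?gauss_pdf_ge0.
- by move=> x; exact: H.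
Qed.

Let m0 := row_mx c c'.
Let S0 := block_mx Sigma 0 0 Gamma.

(** The exponents of the two factors add up, and the weight of either block of z
    is at most the weight of z. *)
Lemma joint_close : exists C e0 : R, [/\ 0 < C, 0 < e0 &
  forall e (Psi : 'rV[R]_d -> 'rV[R]_d) (h : 'rV[R]_d -> 'rV[R]_K) (mu : probability 'rV[R]_d R), 0 <= e <= e0 ->
    measurable_fun setT Psi -> (forall v, enorm (Psi v - c) <= e) ->
    measurable_fun setT h -> (forall v, enorm (h v - c') <= e) ->
    let q := joint_op h Gamma (prediction_op Psi Sigma mu) in
    measurable_fun setT q /\ log_close (e * C) q (gauss_pdf m0 S0)].
Proof.
have [C1 [e1 [C10 e10 H1]]] := prediction_close.
have [C2 [e2 [C20 e20 H2]]] := gauss_pdf_shift c' hGamma.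
exists (C1 + C2), (Num.min e1 e2); split.
- exact: addr_gt0.
- by rewrite lt_min e10.
move=> e Psi h mu /andP[ge0e]; rewrite le_min => /andP[ee1 ee2] mPsi Psic mh hc.
have {}ee1 : 0 <= e <= e1 by rewrite ge0e.
have {}ee2 : 0 <= e <= e2 by rewrite ge0e.
have [mp pc] := H1 e Psi mu ee1 mPsi Psic.
move=> q; split.
  rewrite /q /joint_op; under eq_fun do rewrite gauss_pdfE//.
  apply: measurable_funM; last first.
    by apply: measurableT_comp => //; exact: measurable_lsubmx.
  apply: measurable_funM => //; apply: measurable_gauss_kernel.
    by apply: measurableT_comp => //; exact: measurable_lsubmx.
  exact: measurable_rsubmx.
move=> z; rewrite -[in gauss_pdf m0 S0 z](hsubmxK z) gauss_pdf_row_mx//.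
rewrite /q /joint_op; set u := lsubmx z; set y := rsubmx z.
have wu : weight u <= weight z.
  by rewrite /weight -[z in leRHS]hsubmxK enorm_row_mx_sqr addrA lerDl sqr_ge0.
have wy : weight y <= weight z.
  by rewrite /weight -[z in leRHS]hsubmxK enorm_row_mx_sqr lerD2l lerDr sqr_ge0.
have /andP[p1 p2] := pc u; have /andP[g1 g2] := H2 e (h u) ee2 (hc u) y.
have gy := gauss_pdf_ge0 c' hGamma y; have gu := gauss_pdf_ge0 c hSigma u.
have ghy := gauss_pdf_ge0 (h u) hGamma y.
have wle : e * C2 * weight y + e * C1 * weight u <= e * (C1 + C2) * weight z.
  rewrite (mulrDr e) (mulrDl _ _ (weight z)) addrC.
  by rewrite lerD// ler_wpM2l// mulr_ge0// ltW.
apply/andP; split.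
  apply: (@le_trans _ _ (expR (- (e * C2 * weight y)) * gauss_pdf c' Gamma y *
      (expR (- (e * C1 * weight u)) * gauss_pdf c Sigma u))).
    by rewrite [leRHS]mulrACA -expRD ler_wpM2r ?mulr_ge0// ler_expR -opprD lerN2.
  by apply: ler_pM g1 p1; [exact: mulr_ge0 (expR_ge0 _) gy|exact: mulr_ge0 (expR_ge0 _) gu].
apply: (@le_trans _ _ (expR (e * C2 * weight y) * gauss_pdf c' Gamma y *
      (expR (e * C1 * weight u) * gauss_pdf c Sigma u))).
  apply: ler_pM g2 p2 => //.
  exact: le_trans (mulr_ge0 (expR_ge0 _) gu) p1.
by rewrite [leLHS]mulrACA -expRD ler_wpM2r ?mulr_ge0// ler_expR.
Qed.

(** Conditioning on an observation y in a fixed ball restricts a density to a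
    slice, on which the limiting joint Gaussian is a multiple of N(c, Sigma). *)
Lemma analysis_close (kappa : R) : exists C t0 : R, [/\ 0 < C, 0 < t0 &
  forall tau A (q : 'rV[R]_(d + K) -> R) y, 0 <= tau <= t0 -> 0 < A ->
    measurable_fun setT q -> log_close tau q (fun z => A * gauss_pdf m0 S0 z) ->
    enorm y <= kappa -> near_gauss Sigma c (tau * C) (analysis_op y q)].
Proof.
have [C1 [t1 [C10 t10 _ H]]] := normalization_close c hSigma.
have k0 : 0 < 1 + kappa ^+ 2 by rewrite ltr_pwDl// sqr_ge0.
exists ((1 + kappa ^+ 2) * C1), (t1 / (1 + kappa ^+ 2)); split.
- exact: mulr_gt0.
- exact: divr_gt0.
move=> tau A q y /andP[tau0]; rewrite ler_pdivlMr// => taut A0 mq qc yk.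
pose f u := q (row_mx u y).
have mf : measurable_fun setT f.
  by apply: measurableT_comp => //; exact: measurable_row_mx.
pose B := A * gauss_pdf c' Gamma y.
have B0 : 0 < B by rewrite mulr_gt0// gauss_pdf_gt0.
have ww u : weight (row_mx u y) <= (1 + kappa ^+ 2) * weight u.
  rewrite /weight enorm_row_mx_sqr.
  have : enorm y ^+ 2 <= kappa ^+ 2.
    by rewrite ler_sqr ?nnegrE ?enorm_ge0// (le_trans _ yk) ?enorm_ge0.
  by have := mulr_ge0 (sqr_ge0 kappa) (sqr_ge0 (enorm u)); lra.
have fc : log_close (tau * (1 + kappa ^+ 2)) f (fun u => B * gauss_pdf c Sigma u).
  move=> u; have /andP[h1 h2] := qc (row_mx u y).
  move: h1 h2; rewrite /m0 /S0 gauss_pdf_row_mx// (mulrA A) -/B -/(f u) => h1 h2.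
  have Bg : 0 <= B * gauss_pdf c Sigma u by rewrite mulr_ge0 ?gauss_pdf_ge0// ltW.
  have tw : tau * weight (row_mx u y) <= tau * (1 + kappa ^+ 2) * weight u.
    by rewrite -mulrA ler_wpM2l.
  apply/andP; split.
    by apply: le_trans h1; rewrite ler_wpM2r// ler_expR lerN2.
  by apply: le_trans h2 _; rewrite ler_wpM2r// ler_expR.
have tt1 : 0 <= tau * (1 + kappa ^+ 2) <= t1 by rewrite taut mulr_ge0// ltW.
have [N0 NE fd] := H _ B f tt1 B0 mf fc.
rewrite /near_gauss /analysis_op -/f; split.
- exact: measurable_funM.
- move=> u; rewrite divr_ge0 ?(ltW N0)//.
  have /andP[+ _] := fc u; apply: le_trans.
  by rewrite mulr_ge0 ?expR_ge0// mulr_ge0 ?gauss_pdf_ge0// ltW.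
- have f0 u : 0 <= f u.
    have /andP[+ _] := fc u; apply: le_trans.
    by rewrite mulr_ge0 ?expR_ge0// mulr_ge0 ?gauss_pdf_ge0// ltW.
  under eq_integral do rewrite mulrC EFinM.
  rewrite ge0_integralZl_EFin ?invr_ge0 ?(ltW N0)//.
  + by rewrite {2}NE -EFinM mulVf// gt_eqF.
  + by move=> u _; rewrite lee_fin; exact: f0.
  + exact/measurable_EFinP.
- by rewrite mulrA.
Qed.

(** Uniformity in the law mu is what lets the last step forget the earlier
    ones. *)
Lemma filter_step_near_gauss (kappa eps : R) : 0 < eps -> exists2 delta : R, 0 < delta &
  forall (Psi : 'rV[R]_d -> 'rV[R]_d) (h : 'rV[R]_d -> 'rV[R]_K) (mu : probability 'rV[R]_d R) y,
    measurable_fun setT Psi -> (forall v, enorm (Psi v - c) <= delta) ->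
    continuous h -> (forall v, enorm (h v - c') <= delta) -> enorm y <= kappa ->
    let q := joint_op h Gamma (prediction_op Psi Sigma mu) in
    near_gauss Sigma c eps (analysis_op y q) /\ near_gauss Sigma c eps (analysis_op y (gaussian_op q)).
Proof.
move=> eps0.
have [C1 [e1 [C10 e10 H1]]] := joint_close.
have [C2 [t2 [C20 t20 H2]]] := gaussian_op_log_close m0 (spd_block hSigma hGamma).
have [C3 [t3 [C30 t30 H3]]] := analysis_close kappa.
have near_mono e e' p : e <= e' -> near_gauss Sigma c e p -> near_gauss Sigma c e' p.
  by move=> ee' [? ? ? h]; split => //; apply: le_trans h _; rewrite lee_fin.
(* The log-distance delta C1 of the joint density must meet the smallness
   conditions of both analyses; the projection multiplies it by C2. *)
pose t := Num.min (Num.min t2 (Num.min t3 (t3 / C2))) (Num.min (eps / C3) (eps / (C2 * C3))).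
have t0 : 0 < t by rewrite !lt_min t20 t30 !divr_gt0// mulr_gt0.
pose delta := Num.min e1 (t / C1).
have delta0 : 0 < delta by rewrite lt_min e10 divr_gt0.
exists delta => // Psi h mu y mPsi Psic hcont hc yk q.
have de : 0 <= delta <= e1 by rewrite ge_min lexx ltW.
have [mq qc] := H1 delta Psi h mu de mPsi Psic (continuous_measurable_rV hcont) hc.
set tau := delta * C1 in qc.
have tau0 : 0 <= tau by rewrite mulr_ge0// ltW.
have : tau <= t by rewrite -ler_pdivlMr// ge_min lexx orbT.
rewrite !le_min => /andP[/and3P[taut2 taut3 taut23] /andP[taue1 taue2]].
move: taut23 taue1 taue2; rewrite !ler_pdivlMr ?mulr_gt0// => taut23 taue1 taue2.
split.
  apply: near_mono taue1 _; apply: (H3 _ 1) => //; first by rewrite tau0.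
  by move=> z; rewrite mul1r; exact: qc.
have taut : 0 <= tau <= t2 by rewrite tau0.
have [mgq [A A0 gqc]] := H2 tau q taut mq qc.
apply: (near_mono (tau * C2 * C3)); first by rewrite -mulrA.
by apply: (H3 _ A) => //; rewrite taut23 mulr_ge0// ltW.
Qed.

End filter_step.

Theorem corollary10 (R : realType) (d K J : nat)
  (kappa_y kappa_Psi kappa_h ell_h : R)
  (Sigma : 'M[R]_d) (Gamma : 'M[R]_K) (mu0 : probability 'rV[R]_d R)
  (Psi0 : 'rV[R]_d -> 'rV[R]_d) (h0 : 'rV[R]_d -> 'rV[R]_K)
  (hd : (1 <= d)%N) (hK : (1 <= K)%N) (hJ : (1 <= J)%N)
  (hy : 0 < kappa_y) (hPsi : 0 < kappa_Psi) (hh : 0 < kappa_h)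
  (hell : 0 <= ell_h)
  (hSigma : spd Sigma) (hGamma : spd Gamma) (hmu0 : gaussian_law mu0)
  (hPsi0 : exists c, Psi0 = cst c) (hh0 : exists c, h0 = cst c)
  (eps : R) (heps : 0 < eps) :
  exists delta : R, 0 < delta /\
    (ereal_sup [set
       ereal_sup [set
         dg (gaussian_filter_law Psih.1 Psih.2 Sigma Gamma mu0 Y J)
            (filter_law Psih.1 Psih.2 Sigma Gamma mu0 Y J)
       | Psih in model_ball kappa_Psi kappa_h Psi0 h0 delta]
     | Y in @observation_ball R K J kappa_y]
     <= eps%:E)%E.
Proof.
have [c Psi0E] := hPsi0; have [c' h0E] := hh0.
have eps2 : 0 < eps / 2 by rewrite divr_gt0.
have [delta delta0 step] := filter_step_near_gauss hSigma hGamma c c' kappa_y eps2.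
exists delta; split => //.
apply: ub_ereal_sup => _ [Y YB <-]; apply: ub_ereal_sup => _ [[Psi h] /= PB <-].
have [mPsi _ Psic hcont [_ hc]] := PB.
have {}Psic v : enorm (Psi v - c) <= delta by have := Psic v; rewrite Psi0E.
have {}hc v : enorm (h v - c') <= delta by have := hc v; rewrite h0E.
(* Beyond the last observation Y`_i is the default value 0. *)
have Yk i : enorm Y`_i <= kappa_y.
  have [iJ|Ji] := ltnP i J; first by have := YB (Ordinal iJ); rewrite (tnth_nth 0).
  by rewrite nth_default ?size_tuple// enorm0 ltW.
have near i (mu : probability 'rV[R]_d R) := step Psi h mu Y`_i mPsi Psic hcont hc (Yk i).
have law_prob i : (exists P : probability 'rV[R]_d R,
      filter_law Psi h Sigma Gamma mu0 Y i = P) /\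
    (exists P : probability 'rV[R]_d R,
      gaussian_filter_law Psi h Sigma Gamma mu0 Y i = P).
  elim: i => [|i [[P PE] [G GE]]]; first by split; exists mu0.
  by rewrite /= PE GE; split; apply: near_gauss_probability;
    [exact: (near i P).1|exact: (near i G).2].
case: J hJ Y YB Yk near law_prob => // j _ Y _ _ near law_prob /=.
have [[P ->] [G ->]] := law_prob j.
have := dg_near_gauss hSigma (near j G).2 (near j P).1.
by rewrite mulrC divfK// ?pnatr_eq0.
Qed.
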